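(* Fix $\alpha\ge-1/2$, $1<p<q<\infty$ and $t>0$. Consider the two rescaled Poisson--Jacobi semigroups $$\widetilde P_t^{(\alpha,\beta)}:=U_\beta^{-1}P^{\alpha,\beta}_{t/\sqrt\beta}U_\beta\ \text{ acting on }L^2(\widehat\mu_{\alpha,\beta}),\qquad \widetilde P_t^{(\lambda)}:=V_\lambda^{-1}P^{\lambda-\frac12,\lambda-\frac12}_{t/\sqrt{2\lambda}}V_\lambda\ \text{ acting on }L^2(\widehat\gamma_\lambda).$$ Then $$\big\|\widetilde P_t^{(\alpha,\beta)}\big\|_{L^p(\widehat\mu_{\alpha,\beta})\to L^q(\widehat\mu_{\alpha,\beta})}\longrightarrow+\infty\quad(\beta\to\infty),\qquad \big\|\widetilde P_t^{(\lambda)}\big\|_{L^p(\widehat\gamma_\lambda)\to L^q(\widehat\gamma_\lambda)}\longrightarrow+\infty\quad(\lambda\to\infty).$$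
   Context: For $\alpha,\beta>-1$, $d\mu_{\alpha,\beta}(x)=Z_{\alpha,\beta}^{-1}(1-x)^\alpha(1+x)^\beta\mathbf 1_{(-1,1)}(x)\,dx$ with $Z_{\alpha,\beta}=2^{\alpha+\beta+1}B(\alpha+1,\beta+1)$ is the Jacobi probability measure. The Jacobi operator $L_{\alpha,\beta}f=(1-x^2)f''-[(\alpha+\beta+2)x+\alpha-\beta]f'$ is realized as the self-adjoint operator on $L^2(\mu_{\alpha,\beta})$ diagonalized by the orthonormal basis of $L^2(\mu_{\alpha,\beta})$-normalized Jacobi polynomials (degree $n$), with eigenvalue $-n(n+\alpha+\beta+1)$, $n\in\mathbb N_0$. The Poisson--Jacobi semigroup is $P_t^{\alpha,\beta}=e^{-t(-L_{\alpha,\beta})^{1/2}}$, a contraction on every $L^r(\mu_{\alpha,\beta})$, $1\le r\le\infty$. Jacobi-to-Laguerre rescaling ($\beta>0$): $\widehat\mu_{\alpha,\beta}$ is the image of $\mu_{\alpha,\beta}$ under $x\mapsto\frac\beta2(1-x)$, i.e. the probability measure on $(0,\beta)$ with density $\frac{\beta^{-(\alpha+1)}}{B(\alpha+1,\beta+1)}\,y^\alpha(1-\frac y\beta)^\beta$, and $U_\beta:L^r(\widehat\mu_{\alpha,\beta})\to L^r(\mu_{\alpha,\beta})$, $(U_\beta f)(x)=f(\frac\beta2(1-x))$, which is an isometric isomorphism for every $r\in[1,\infty]$. Gegenbauer-to-Hermite rescaling ($\lambda>0$): $\widehat\gamma_\lambda$ is the image of $\mu_{\lambda-\frac12,\lambda-\frac12}$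 under $x\mapsto\sqrt\lambda\,x$, i.e. the probability measure on $(-\sqrt\lambda,\sqrt\lambda)$ with density $\frac{1}{\sqrt\lambda\,Z_{\lambda-\frac12,\lambda-\frac12}}(1-\frac{y^2}\lambda)^{\lambda-\frac12}$, and $V_\lambda:L^r(\widehat\gamma_\lambda)\to L^r(\mu_{\lambda-\frac12,\lambda-\frac12})$, $(V_\lambda f)(x)=f(\sqrt\lambda\,x)$, which is an isometric isomorphism for every $r\in[1,\infty]$. Operator norms take values in $[0,+\infty]$. *)

(* Defs.v *)
From HB Require Import structures.
From mathcomp Require Import all_boot all_order all_algebra.
From mathcomp Require Import all_classical all_reals all_analysis.
From mathcomp Require Import measurable_realfun.
From mathcomp Require Import ring.

Set Implicit Arguments.
Unset Strict Implicit.
Unset Printing Implicit Defensive.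

Import Order.TTheory GRing.Theory Num.Theory.
Import numFieldNormedType.Exports.

Local Open Scope classical_set_scope.
Local Open Scope ring_scope.

(* Elements of L^r(mu) are represented by functions R -> R, and operators on
   L^2(mu) by maps (R -> R) -> (R -> R) whose values are representatives of
   the intended almost-everywhere classes. *)

(* Euler's Beta function for real arguments; the library's [beta_fun] only
   takes arguments in nat. *)
Definition euler_beta {R : realType} (u v : R) : R :=
  \int[lebesgue_measure]_(x in `]0%R, 1%R[) (x `^ (u - 1) * (1 - x) `^ (v - 1)).

Definition jacobi_const {R : realType} (a b : R) : R :=
  2 `^ (a + b + 1) * euler_beta (a + 1) (b + 1).

Definition jacobi_density {R : realType} (a b : R) (x : R) : R :=
  (jacobi_const a b)^-1 * ((1 - x) `^ a * (1 + x) `^ b * \1_(`]-1, 1[) x).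

Definition jacobi_measure {R : realType} (a b : R) : set R -> \bar R :=
  fun A => (\int[lebesgue_measure]_(x in A) (jacobi_density a b x)%:E)%E.

Section jacobi_measure_is_measure.
Context {R : realType} (a b : R).

Lemma euler_beta_ge0 (u v : R) : 0 <= euler_beta u v.
Proof. by apply: Rintegral_ge0 => x _; rewrite mulr_ge0 ?powR_ge0. Qed.

Lemma jacobi_density_ge0 (x : R) : 0 <= jacobi_density a b x.
Proof.
by rewrite mulr_ge0 ?invr_ge0 ?mulr_ge0 ?powR_ge0 ?euler_beta_ge0.
Qed.

Lemma measurable_jacobi_density : measurable_fun [set: R] (jacobi_density a b).
Proof.
apply: measurable_funM => //; apply: measurable_funM; last exact: measurable_indic.
apply: measurable_funM; apply: (@measurableT_comp _ _ _ _ _ _ (@powR R ^~ _)) => //.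
  exact: measurable_funB.
exact: measurable_funD.
Qed.

Let jacobi_measure0 : jacobi_measure a b set0 = 0%E.
Proof. by rewrite /jacobi_measure integral_set0. Qed.

Let jacobi_measure_ge0 A : (0 <= jacobi_measure a b A)%E.
Proof. by apply: integral_ge0 => x _; rewrite lee_fin jacobi_density_ge0. Qed.

Let jacobi_measure_sigma_additive : semi_sigma_additive (jacobi_measure a b).
Proof.
move=> /= F mF tF mUF.
rewrite /jacobi_measure ge0_integral_bigcup//=.
- apply: is_cvg_ereal_nneg_natsum_cond => n _ _.
  by apply: integral_ge0 => x _; rewrite lee_fin jacobi_density_ge0.
- by apply/measurable_EFinP/measurable_funTS; exact: measurable_jacobi_density.
- by move=> x _; rewrite lee_fin jacobi_density_ge0.
Qed.

HB.instance Definition _ := isMeasure.Build _ _ _ (jacobi_measure a b)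
  jacobi_measure0 jacobi_measure_ge0 jacobi_measure_sigma_additive.

End jacobi_measure_is_measure.

Definition pochhammer {R : realType} (x : R) (k : nat) : R :=
  \prod_(i < k) (x + i%:R).

(* The Jacobi polynomial P_n^(a,b) in its hypergeometric form
   (a+1)_n / n! * 2F1(-n, n+a+b+1; a+1; (1-x)/2); its denominators do not
   vanish for a > -1. *)
Definition jacobi_poly {R : realType} (a b : R) (n : nat) : {poly R} :=
  (pochhammer (a + 1) n / n`!%:R) *:
  \sum_(k < n.+1)
    (pochhammer (- n%:R) k * pochhammer (n%:R + a + b + 1) k
       / (pochhammer (a + 1) k * k`!%:R)) *: (2^-1 *: (1 - 'X)) ^+ k.

Definition jacobi_onb {R : realType} (a b : R) (n : nat) (x : R) : R :=
  (jacobi_poly a b n).[x] /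
  fine ('N[jacobi_measure a b]_2%:E [EFin \o horner (jacobi_poly a b n)])%E.

Definition jacobi_eigenvalue {R : realType} (a b : R) (n : nat) : R :=
  - (n%:R * (n%:R + a + b + 1)).

Definition jacobi_coef {R : realType} (a b : R) (f : R -> R) (n : nat) : R :=
  \int[jacobi_measure a b]_x (f x * jacobi_onb a b n x).

(* Functional calculus of the self-adjoint Jacobi operator L_(a,b) through its
   diagonalization: [jacobi_calculus a b phi f] is (a representative of)
   phi(L_(a,b)) f, the L^2-sum of phi(eigenvalue_n) <f, e_n> e_n. *)
Definition jacobi_calculus {R : realType} (a b : R) (phi : R -> R)
    (f : R -> R) : R -> R :=
  xget (cst 0) [set g : R -> R | g \in Lfun (jacobi_measure a b) 2%:E /\
    ('N[jacobi_measure a b]_2%:E [EFin \o (fun x => g x -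
       \sum_(n < N) phi (jacobi_eigenvalue a b n) * jacobi_coef a b f n
                    * jacobi_onb a b n x)%R])%E @[N --> \oo] --> 0%E].

Definition poisson_jacobi {R : realType} (a b t : R) : (R -> R) -> R -> R :=
  jacobi_calculus a b (fun l => expR (- t * Num.sqrt (- l))).

(* Jacobi-to-Laguerre change of variables, on (-1, 1) and back. *)
Definition jl_map {R : realType} (b : R) (x : R) : R := b / 2 * (1 - x).
Definition jl_inv {R : realType} (b : R) (y : R) : R := 1 - 2 / b * y.

(* Gegenbauer-to-Hermite change of variables, on (-1, 1) and back. *)
Definition gh_map {R : realType} (l : R) (x : R) : R := Num.sqrt l * x.
Definition gh_inv {R : realType} (l : R) (y : R) : R := y / Num.sqrt l.

Lemma jl_mapK {R : realType} (b : R) : 0 < b ->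
  cancel (jl_map b) (jl_inv b) /\ cancel (jl_inv b) (jl_map b).
Proof.
by move=> b0; split=> x; rewrite /jl_map /jl_inv; field; rewrite gt_eqF.
Qed.

Lemma gh_mapK {R : realType} (l : R) : 0 < l ->
  cancel (gh_map l) (gh_inv l) /\ cancel (gh_inv l) (gh_map l).
Proof.
rewrite -sqrtr_gt0 => l0.
by split=> x; rewrite /gh_map /gh_inv; field; rewrite gt_eqF.
Qed.

Lemma measurable_jl_map {R : realType} (b : R) :
  measurable_fun [set: R] (jl_map b).
Proof. by apply: measurable_funM => //; exact: measurable_funB. Qed.

Lemma measurable_gh_map {R : realType} (l : R) :
  measurable_fun [set: R] (gh_map l).
Proof. exact: measurable_funM. Qed.

Definition jl_measure {R : realType} (a b : R) : set R -> \bar R :=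
  pushforward (jacobi_measure a b) (jl_map b).

Definition gh_measure {R : realType} (l : R) : set R -> \bar R :=
  pushforward (jacobi_measure (l - 2^-1) (l - 2^-1)) (gh_map l).

Section rescaled_measures.
Context {R : realType} (a b l : R).

Let mjl := measurable_jl_map b.
Let mgh := measurable_gh_map l.

Let jl_measure0 : jl_measure a b set0 = 0%E.
Proof. exact: measure0. Qed.

Let jl_measure_ge0 A : (0 <= jl_measure a b A)%E.
Proof. exact: measure_ge0. Qed.

Let jl_measure_sigma_additive : semi_sigma_additive (jl_measure a b).
Proof. exact: measure_semi_sigma_additive. Qed.

HB.instance Definition _ := isMeasure.Build _ _ _ (jl_measure a b)
  jl_measure0 jl_measure_ge0 jl_measure_sigma_additive.

Let gh_measure0 : gh_measure l set0 = 0%E.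
Proof. exact: measure0. Qed.

Let gh_measure_ge0 A : (0 <= gh_measure l A)%E.
Proof. exact: measure_ge0. Qed.

Let gh_measure_sigma_additive : semi_sigma_additive (gh_measure l).
Proof. exact: measure_semi_sigma_additive. Qed.

HB.instance Definition _ := isMeasure.Build _ _ _ (gh_measure l)
  gh_measure0 gh_measure_ge0 gh_measure_sigma_additive.

End rescaled_measures.

(* U_beta^-1 o P_(t / sqrt beta)^(alpha, beta) o U_beta, with U_beta the
   composition with [jl_map beta]. *)
Definition jl_poisson {R : realType} (a b t : R) (f : R -> R) : R -> R :=
  poisson_jacobi a b (t / Num.sqrt b) (f \o jl_map b) \o jl_inv b.

(* V_lambda^-1 o P_(t / sqrt (2 lambda))^(lambda - 1/2, lambda - 1/2)
   o V_lambda, with V_lambda the composition with [gh_map lambda]. *)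
Definition gh_poisson {R : realType} (l t : R) (f : R -> R) : R -> R :=
  poisson_jacobi (l - 2^-1) (l - 2^-1) (t / Num.sqrt (2 * l)) (f \o gh_map l)
    \o gh_inv l.

(* Norm from L^p(mu) to L^q(mu), possibly +oo, of an operator S given on
   L^2(mu): the supremum of |S f|_q over the f in L^2 and L^p with
   |f|_p <= 1. *)
Definition opnorm {R : realType} (mu : {measure set R -> \bar R}) (p q : R)
    (S : (R -> R) -> R -> R) : \bar R :=
  ereal_sup [set 'N[mu]_q%:E [EFin \o S f]%E | f in
    [set f : R -> R | f \in Lfun mu 2%:E /\ ('N[mu]_p%:E [EFin \o f] <= 1)%E]].

(* Main.v *)
Require Import Defs.
From HB Require Import structures.
From mathcomp Require Import all_boot all_order all_algebra.
From mathcomp Require Import all_classical all_reals all_analysis.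
From mathcomp Require Import measurable_realfun.
From mathcomp Require Import ring lra.

Set Implicit Arguments.
Unset Strict Implicit.
Unset Printing Implicit Defensive.

Import Order.TTheory GRing.Theory Num.Theory.
Import numFieldNormedType.Exports.

Local Open Scope classical_set_scope.
Local Open Scope ring_scope.

(* Let L be the Jacobi operator, e_n its orthonormal polynomials, E the expectation
   for the Jacobi measure, and v = (1 - x) / 2 (respectively v = x^2 in the
   Gegenbauer case).  Then L v^(k+1) = d_k v^k - th_(k+1) v^(k+1) with d_k >= 0 and
   th increasing.  Pairing with e_n gives a first-order recurrence in k for
   <v^k, e_n>, so for fixed n all these numbers have the same sign.  Every term of
   <P v^m, v^M> = sum_n exp(-s sqrt(lambda_n)) <v^m, e_n> <v^M, e_n> is therefore
   nonnegative, and <P v^m, v^M> is at least the smallest multiplier times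
   E v^(m+M).  Since |v|^M is extremal in Hoelder's inequality for v^m when
   M = m (q - 1), up to that multiplier the operator P does not decrease the L^q
   norm of v^m.  In the scaling limit E v^k behaves like (c)_k / s^k with s tending
   to infinity, so |v^m|_q / |v^m|_p grows exponentially in m, whereas the
   multiplier is only exp(- O(sqrt m)). *)

(** * Integrals with respect to a density, and an affine substitution *)

Section density.
Context d (T : measurableType d) (R : realType).
Variables (mu nu : {measure set T -> \bar R}) (g : T -> R).
Hypotheses (g0 : forall x, 0 <= g x) (mg : measurable_fun setT g).
Hypothesis nuE : forall A, measurable A -> nu A = (\int[mu]_(x in A) (g x)%:E)%E.
Local Open Scope ereal_scope.

Import HBNNSimple.

(** Monotone convergence along simple approximations of [f] reduces both sides to simple functions,
    additivity reduces those to indicators, and there the identity is [nuE]. *)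
Lemma ge0_integral_density (f : T -> \bar R) :
  (forall x, 0 <= f x) -> measurable_fun setT f ->
  \int[nu]_x f x = \int[mu]_x (f x * (g x)%:E).
Proof.
move=> f0 mf; pose h := nnsfun_approx measurableT mf.
have mge : measurable_fun setT (EFin \o g) by exact/measurable_EFinP.
transitivity (lim (\int[nu]_x (EFin \o h n) x @[n --> \oo])).
  rewrite -monotone_convergence//.
  - apply: eq_integral => x _; apply/esym/cvg_lim => //.
    exact: cvg_nnsfun_approx.
  - by move=> n; exact/measurable_EFinP.
  - by move=> n x _; rewrite lee_fin.
  - by move=> x _ m n mn; rewrite lee_fin; exact/lefP/nd_nnsfun_approx.
transitivity (lim (\int[mu]_x ((EFin \o h n) x * (g x)%:E) @[n --> \oo]));
    last first.
  rewrite -monotone_convergence//.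
  - apply: eq_integral => x _; apply/cvg_lim => //.
    by apply: cvgeZr => //; exact: cvg_nnsfun_approx.
  - by move=> n; apply: emeasurable_funM => //; exact/measurable_EFinP.
  - by move=> n x _; rewrite mule_ge0 ?lee_fin.
  - move=> x _ m n mn; rewrite lee_wpmul2r ?lee_fin//.
    exact/lefP/nd_nnsfun_approx.
suff hE n : \int[nu]_x (EFin \o h n) x = \int[mu]_x ((EFin \o h n) x * (g x)%:E).
  by under eq_fun do rewrite hE.
transitivity (\int[nu]_x
    (\sum_(y \in range (h n)) (y * \1_(h n @^-1` [set y]) x)%:E)).
  by apply: eq_integral => t _; rewrite /= fimfunE -fsumEFin.
have indich r : measurable_fun setT (fun x => (r * \1_(h n @^-1` [set r]) x)%:E).
  by apply/measurable_EFinP; exact: measurable_funM.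
rewrite ge0_integral_fsum//; last by move=> y x _; exact: nnfun_muleindic_ge0.
transitivity (\int[mu]_x (\sum_(y \in range (h n))
    ((y * \1_(h n @^-1` [set y]) x)%:E * (g x)%:E))); last first.
  apply: eq_integral => x _.
  rewrite -ge0_mule_fsuml => [|y]; last exact: nnfun_muleindic_ge0.
  by rewrite fsumEFin// -(fimfunE _ x).
rewrite ge0_integral_fsum//; last 2 first.
  - by move=> y; apply: emeasurable_funM.
  - by move=> y x _; apply: mule_ge0; rewrite ?lee_fin//; exact: nnfun_muleindic_ge0.
apply: eq_fsbigr => r; rewrite inE => -[t _ <-].
under eq_integral do rewrite EFinM.
rewrite integralZl_indic_nnsfun//.
under [RHS]eq_integral do rewrite EFinM -muleA.
rewrite ge0_integralZl//; last 3 first.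
- by apply: emeasurable_funM => //; exact/measurable_EFinP.
- by move=> x _; rewrite mule_ge0 ?lee_fin.
- by rewrite lee_fin.
congr (_ * _); rewrite integral_indic// setIT nuE// integral_mkcond.
by apply: eq_integral => x _; rewrite epatch_indic muleC.
Qed.

End density.

(** Twice Lebesgue measure, pushed forward by [1 - 2 * x], agrees with Lebesgue measure on half-open
    intervals, hence everywhere. This substitution carries the Jacobi weight on (-1, 1) to the Beta
    kernel on (0, 1). *)
Lemma ge0_integral_affine (R : realType) (f : R -> \bar R) :
  (forall x, 0 <= f x)%E -> measurable_fun setT f ->
  (\int[lebesgue_measure]_x f x =
   2%:E * \int[lebesgue_measure]_x f (1 - 2 * x)%R)%E.
Proof.
move=> f0 mf.
have mphi : measurable_fun setT (fun x : R => 1 - 2 * x : measurableTypeR R).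
  by apply: measurable_funB => //; exact: measurable_funM.
transitivity (\int[pushforward (mscale (2%:nng)%R (@lebesgue_measure R))
    (fun x : R => 1 - 2 * x : measurableTypeR R)%R]_x f x)%E.
  apply: eq_measure_integral => A mA _.
  apply: lebesgue_measure_unique => // _ [[a b]] _ <-.
  (* The map reverses orientation, so the preimage of an interval closed on the right is closed on
     the left. *)
  transitivity (2%:E * lebesgue_measure `[((1 - b) / 2)%R, ((1 - a) / 2)%R[%classic)%E;
    last first.
    rewrite /= /pushforward /mscale/=; congr (_ * lebesgue_measure _)%E.
    by apply/seteqP; split=> x /=; rewrite !in_itv/=; lra.
  rewrite !lebesgue_measure_itv/= !lte_fin ltr_pM2r ?invr_gt0// ltrD2l ltrN2.
  case: ifP => _; last by rewrite mule0.
  by rewrite -!EFinD -EFinM; congr EFin; field.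
rewrite ge0_integral_pushforward// preimage_setT ge0_integral_mscale//.
- by apply: measurableT_comp.
- by move=> x _; exact: f0.
Qed.

(** * The fundamental theorem of calculus with singular endpoints *)

(** Here [f] may blow up at the endpoints, as the Jacobi weight does. The running integral [P] is
    continuous on [a, b] by integrability alone, [P - F] is constant inside by the usual theorem on
    compact subintervals, and one-sided limits extend this to a and b. *)
Lemma FTC2_oo (R : realType) (f F : R -> R) (a b : R) : a < b ->
  lebesgue_measure.-integrable `[a, b] (EFin \o f) ->
  {in `]a, b[, continuous f} ->
  derivable_oo_LRcontinuous F a b ->
  {in `]a, b[, F^`()%classic =1 f} ->
  \int[lebesgue_measure]_(x in `[a, b]) f x = F b - F a.
Proof.
move=> ab intf cf dF F'f.
pose P x := \int[lebesgue_measure]_(t in `[a, x]) f t.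
have /(continuous_within_itvP _ ab)[_ Pa Pb] : {within `[a, b], continuous P}.
  exact: parameterized_integral_continuous (ltW ab) intf.
have [dFo Fa Fb] := dF.
pose m := (a + b) / 2.
have [am mb] : a < m /\ m < b by rewrite /m; split; lra.
have PFle z c : a < z -> z < c -> c < b -> P c - F c = P z - F z.
  move=> az zc cb.
  have zcab x : x \in `[z, c] -> x \in `]a, b[.
    by rewrite !in_itv/=; lra.
  have cF x : x \in `[z, c] -> {for x, continuous F}.
    by move=> /zcab xab; exact/differentiable_continuous/derivable1_diffP/dFo.
  have : \int[lebesgue_measure]_(x in `[z, c]) f x = F c - F z.
    rewrite /Rintegral (@continuous_FTC2 _ f F)//.
    - by apply: continuous_in_subspaceT => x; rewrite inE => /zcab; exact: cf.
    - split.
      + by move=> x xzc; apply/dFo/zcab; exact: subset_itv_oo_cc.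
      + by apply/cvg_at_right_filter/cF; rewrite in_itv/= lexx ltW.
      + by apply/cvg_at_left_filter/cF; rewrite in_itv/= lexx ltW.
    - by move=> x xzc; apply/F'f/zcab; exact: subset_itv_oo_cc.
  have intac : lebesgue_measure.-integrable `[a, c] (EFin \o f).
    by apply: integrableS intf => //; apply: subset_itvl; rewrite bnd_simp ltW.
  rewrite -Rintegral_itv_obnd_cbnd; last first.
    apply: integrableS intac => //; apply: subset_itvr; rewrite bnd_simp.
    exact: ltW.
  rewrite -(@Rintegral_itvB _ _ (BLeft a))//= ?bnd_simp//; try exact/ltW.
  by rewrite -/(P c) -/(P z) => PFE; lra.
have PF x : a < x < b -> P x - F x = P m - F m.
  move=> /andP[ax xb]; have [xm|mx|->//] := ltgtP x m.
  - by rewrite (PFle x m).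
  - by rewrite (PFle m x).
have Hb : P b - F b = P m - F m.
  apply: (cvg_unique (@norm_hausdorff _ R) (F := P x - F x @[x --> b^'-])).
    by rewrite /=; exact: cvgB.
  rewrite /=; apply: cvg_near_cst; near=> x; apply/PF/andP; split.
  - by near: x; exact: nbhs_left_gt.
  - by near: x; exact: nbhs_left_lt.
have Ha : P a - F a = P m - F m.
  apply: (cvg_unique (@norm_hausdorff _ R) (F := P x - F x @[x --> a^'+])).
    by rewrite /=; exact: cvgB.
  rewrite /=; apply: cvg_near_cst; near=> x; apply/PF/andP; split.
  - by near: x; exact: nbhs_right_gt.
  - by near: x; exact: nbhs_right_lt.
have P0 : P a = 0 by rewrite /P set_itv1 Rintegral_set1.
by rewrite -/(P b); move: Ha; rewrite -Hb P0 => Ha; lra.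
Unshelve. all: by end_near. Qed.

(** On each interval [1/(n+2), 1] the explicit primitive bounds the integral by 1/(a+1); monotone
    convergence passes this bound to (0, 1]. *)
Lemma integrable_powR01 (R : realType) (a : R) : -1 < a ->
  lebesgue_measure.-integrable `]0, 1] (fun x => (x `^ a)%:E).
Proof.
move=> a1.
have mp (D : set R) : measurable_fun D (fun x => (x `^ a)%:E).
  by apply/measurable_EFinP/measurable_funTS; exact: measurable_powR.
apply/integrableP; split; first exact: mp.
under eq_integral do rewrite /= ger0_norm ?powR_ge0//.
(* With [n.+2] the left endpoint is strictly below 1 even for n = 0, as the fundamental theorem
   requires. *)
pose A n := `[n.+2%:R^-1 : R, 1]%classic.
have AE : \bigcup_n A n = `]0, 1]%classic.
  apply/seteqP; split=> [x [n _]|x]; rewrite /A /= !in_itv/= => /andP[x0 x1].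

    by rewrite x1 (lt_le_trans _ x0).
  exists (Num.truncn x^-1) => //; rewrite /A/= in_itv/= x1 andbT.
  rewrite invf_ple ?posrE ?ltr0n//.
  rewrite (le_trans (ltW (truncnS_gt _)))// ler_nat.
  exact: leqnSn.
have a10 : 0 < a + 1 by rewrite -ltrBlDr sub0r.
have ndA : nondecreasing_seq A.
  move=> m n mn; rewrite /A subsetEset; apply: subset_itvr; rewrite bnd_simp.
  by rewrite lef_pV2 ?posrE ?ltr0n// ler_nat.
have pA (x : R) : (0 <= (x `^ a)%:E)%E by rewrite lee_fin powR_ge0.
have := @ge0_nondecreasing_set_cvg_integral _ (measurableTypeR R) R A (fun x => (x `^ a)%:E)
  lebesgue_measure ndA (fun n => measurable_itv _) (fun n => mp _)
  _.
rewrite AE => /(_ (fun _ _ _ => pA _)) cvgA.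
apply: (@le_lt_trans _ _ (a + 1)^-1%:E); last by rewrite ltry.
rewrite -(cvg_lim _ cvgA)//; apply: lime_le; first by apply/cvg_ex; eexists; exact: cvgA.
near=> n.
have x0 (x : R) : x \in `[n.+2%:R^-1, 1] -> 0 < x.
  by rewrite in_itv/= => /andP[+ _]; apply: lt_le_trans; rewrite invr_gt0 ltr0n.
have dp (x : R) : 0 < x -> is_derive x 1 (fun x => (a + 1)^-1 * x `^ (a + 1)) (x `^ a).
  move=> {}x0; have dx := is_deriveZ (a + 1)^-1 (is_derive1_powR (a + 1) x0).
  by apply: (is_derive_eq dx); rewrite addrK /GRing.scale/= mulrA mulVf ?gt_eqF// mul1r.
have cF (x : R) : 0 < x -> {for x, continuous (fun x => (a + 1)^-1 * x `^ (a + 1))}.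
  by move=> /dp[dpx _]; exact/differentiable_continuous/derivable1_diffP.
rewrite (@continuous_FTC2 _ _ (fun x => (a + 1)^-1 * x `^ (a + 1))).
- rewrite powR1 mulr1 -EFinB lee_fin gerBl mulr_ge0 ?powR_ge0// invr_ge0.
  exact: ltW.
- by rewrite invf_lt1// ltr1n.
- apply: continuous_in_subspaceT => x; rewrite inE/= => /x0 {}x0.
  apply/differentiable_continuous/derivable1_diffP/derivable_powR.
  by rewrite in_itv/= x0.
- split.
  + by move=> x /subset_itv_oo_cc/x0/dp[].
  + by apply/cvg_at_right_filter/cF; rewrite invr_gt0 ltr0n.
  + exact/cvg_at_left_filter/cF.
- move=> x /subset_itv_oo_cc/x0/dp xp; rewrite derive1E; by rewrite derive_val.
Unshelve. all: by end_near. Qed.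

(** * Total mass of the Jacobi measure *)

Section jacobi_mass.
Context (R : realType) (a b : R).
Hypotheses (a1 : -1 < a) (b0 : 0 <= b).
Local Notation lambda := (@lebesgue_measure R).

Lemma beta_kernel_ge0 (x : R) : 0 <= x `^ a * (1 - x) `^ b.
Proof. by rewrite mulr_ge0 ?powR_ge0. Qed.

Lemma measurable_beta_kernel (D : set R) :
  measurable_fun D (fun x : R => x `^ a * (1 - x) `^ b).
Proof.
apply: measurable_funTS; apply: measurable_funM.
  exact: measurable_powR.
apply: (@measurableT_comp _ _ _ _ _ _ (@powR R ^~ b)) => //.
exact: measurable_funB.
Qed.

Lemma integrable_beta_kernel :
  lambda.-integrable `]0, 1[ (fun x => (x `^ a * (1 - x) `^ b)%:E).
Proof.
have intp : lambda.-integrable `]0, 1[ (fun x => (x `^ a)%:E).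
  by apply: integrableS (integrable_powR01 a1) => //; exact: subset_itv_oo_oc.
apply: le_integrable intp => //.
  by apply/measurable_EFinP; exact: measurable_beta_kernel.
move=> x /=; rewrite in_itv/= => /andP[x0 x1].
rewrite lee_fin !ger0_norm ?beta_kernel_ge0 ?powR_ge0// ler_piMr ?powR_ge0//.
rewrite [leRHS](_ : 1 = 1 `^ b); last by rewrite powR1.
by apply: ge0_ler_powR; rewrite ?nnegrE//; lra.
Qed.

Lemma euler_beta_kernel :
  (euler_beta (a + 1) (b + 1))%:E =
  (\int[lambda]_(x in `]0%R, 1%R[) (x `^ a * (1 - x) `^ b)%:E)%E.
Proof.
rewrite /euler_beta !addrK /Rintegral fineK//.
by apply: integrable_fin_num => //; exact: integrable_beta_kernel.
Qed.

Lemma euler_beta_gt0 : 0 < euler_beta (a + 1) (b + 1).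
Proof.
rewrite lt_neqAle euler_beta_ge0 andbT; apply/negP => /eqP B0.
have mf : measurable_fun (`]0%R, 1%R[%classic : set R)
    (fun x : R => (x `^ a * (1 - x) `^ b)%:E).
  by apply/measurable_EFinP; exact: measurable_beta_kernel.
have /(ae_eq_integral_abs lambda (measurable_itv _) mf) :
    (\int[lambda]_(x in `]0%R, 1%R[) `|(x `^ a * (1 - x) `^ b)%:E| = 0)%E.
  under eq_integral do rewrite gee0_abs ?lee_fin ?beta_kernel_ge0//.
  by rewrite -euler_beta_kernel -B0.
move=> f0.
have /negligibleP : lambda.-negligible `]0, 1[%classic.
  apply: negligibleS f0 => x /= x01 /(_ x01) /eqP; rewrite eqe.
  move: x01; rewrite in_itv/= => /andP[x0 x1].
  by rewrite gt_eqF// mulr_gt0// powR_gt0// subr_gt0.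
move=> /(_ (measurable_itv _)) l0; have := lebesgue_measure_itv (`]0, 1[ : interval R).
by rewrite [LHS]l0 /= lte_fin ltr01 sube0 => /esym/eqP; rewrite eqe oner_eq0.
Qed.

Lemma jacobi_const_gt0 : 0 < jacobi_const a b.
Proof. by rewrite mulr_gt0 ?powR_gt0 ?euler_beta_gt0. Qed.

Lemma jacobi_measureT : jacobi_measure a b setT = 1%E.
Proof.
rewrite /jacobi_measure ge0_integral_affine; last 2 first.
- by move=> x; rewrite lee_fin jacobi_density_ge0.
- by apply/measurable_EFinP; exact: measurable_jacobi_density.
(* The substitution turns 1 - x and 1 + x into 2x and 2(1 - x): the power of 2 goes into [c], and
   the Jacobian supplies the last factor 2 of [jacobi_const]. *)
pose c := (jacobi_const a b)^-1 * 2 `^ (a + b).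
have c0 : 0 <= c by rewrite mulr_ge0 ?powR_ge0// invr_ge0 ltW ?jacobi_const_gt0.
transitivity (2%:E * (c%:E * (euler_beta (a + 1) (b + 1))%:E))%E; last first.
  rewrite -!EFinM /c /jacobi_const; congr EFin.
  rewrite [2 `^ (a + b + 1)]powRD ?pnatr_eq0 ?implybT// powRr1//; field.
  by rewrite !gt_eqF ?euler_beta_gt0 ?powR_gt0.
rewrite euler_beta_kernel [in RHS]integral_mkcond -[in RHS]ge0_integralZl//; last 2 first.
- apply/(measurable_restrictT _ _).1 => //.
  by apply/measurable_EFinP; exact: measurable_beta_kernel.
- by move=> x _; rewrite patchE; case: ifPn; rewrite ?lee_fin ?beta_kernel_ge0.
congr (_ * _)%E; apply: eq_integral => x _.
rewrite patchE /jacobi_density indicE /c.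
have -> : (1 - 2 * x \in `]-1, 1[%classic) = (x \in `]0, 1[%classic).
  by apply/idP/idP; rewrite !inE/= !in_itv/=; lra.
case: ifPn => [|_]; last by rewrite !mulr0 mule0.
rewrite inE/= in_itv/= => /andP[x0 x1]; rewrite mulr1 -EFinM; congr EFin.
rewrite (_ : 1 - (1 - 2 * x) = 2 * x); last by ring.
rewrite (_ : 1 + (1 - 2 * x) = 2 * (1 - x)); last by ring.
rewrite !powRM ?powRD ?pnatr_eq0 ?implybT//; [ring|lra|lra].
Qed.

End jacobi_mass.

(** * Expectations of polynomials *)

Lemma horner_bound (R : realType) (p : {poly R}) :
  exists2 M : R, 0 <= M & forall x, x \in `]-1, 1[ -> `|p.[x]| <= M.
Proof.
exists (\sum_(i < size p) `|p`_i|); first by rewrite sumr_ge0.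
move=> x; rewrite in_itv/= => x1; rewrite horner_coef.
apply: (le_trans (ler_norm_sum _ _ _)); apply: ler_sum => i _.
rewrite normrM ler_piMr// normrX exprn_ile1//.
by rewrite ler_norml; lra.
Qed.

Lemma measurable_horner (R : realType) (p : {poly R}) (D : set R) :
  measurable_fun D (horner p).
Proof.
apply: measurable_funTS; apply: continuous_measurable_fun => x.
exact: continuous_horner.
Qed.

Lemma is_derive_powR_1B (R : realType) (c x : R) : x < 1 ->
  is_derive x 1 (fun y => (1 - y) `^ c) (- (c * (1 - x) `^ (c - 1))).
Proof.
move=> x1; have x0 : 0 < 1 - x by rewrite subr_gt0.
have d1 : is_derive x 1 (fun y : R => 1 - y) (-1).
  have d1 := is_deriveB (is_derive_cst (1 : R) x 1) (is_derive_id x 1).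
  by apply: (is_derive_eq d1); rewrite sub0r.
have d2 := @is_derive1_comp R (fun y => y `^ c) (fun y => 1 - y) x _ _ (is_derive1_powR c x0) d1.
by apply: (is_derive_eq d2); rewrite mulrN1.
Qed.

Lemma is_derive_powR_1D (R : realType) (c x : R) : -1 < x ->
  is_derive x 1 (fun y => (1 + y) `^ c) (c * (1 + x) `^ (c - 1)).
Proof.
move=> x1; have x0 : 0 < 1 + x by lra.
have d1 : is_derive x 1 (fun y : R => 1 + y) 1.
  have d1 := is_deriveD (is_derive_cst (1 : R) x 1) (is_derive_id x 1).
  by apply: (is_derive_eq d1); rewrite add0r.
have d2 := @is_derive1_comp R (fun y => y `^ c) (fun y => 1 + y) x _ _ (is_derive1_powR c x0) d1.
by apply: (is_derive_eq d2); rewrite mulr1.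
Qed.

Section jacobi_exp.
Context (R : realType) (a b : R).
Hypotheses (a1 : -1 < a) (b0 : 0 <= b).
Local Notation lambda := (@lebesgue_measure R).
Local Notation mu := (jacobi_measure a b).

Lemma ge0_integral_jacobi (f : R -> \bar R) : (forall x, 0 <= f x)%E ->
  measurable_fun setT f ->
  (\int[mu]_x f x = \int[lambda]_x (f x * (jacobi_density a b x)%:E))%E.
Proof.
move=> f0 mf.
(* [jacobi_measure] lives on [R] and [lebesgue_measure] on [measurableTypeR R]:
   same sets, different displays, so we transport along the identity. *)
have mid : measurable_fun setT (fun x : R => x : measurableTypeR R).
  by move=> _ A mA; rewrite setTI.
transitivity (\int[pushforward mu (fun x : R => x : measurableTypeR R)]_x f x)%E.
  by rewrite ge0_integral_pushforward.
apply: (@ge0_integral_density _ _ R lambda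
  (measure_function_pushforward__canonical__measure_function_Measure mu mid)
  (jacobi_density a b)) => //.
- by move=> x; exact: jacobi_density_ge0.
- exact: measurable_jacobi_density.
Qed.

Lemma integral_jacobi (f : R -> R) : measurable_fun setT f ->
  (\int[mu]_x (f x)%:E = \int[lambda]_x (f x * jacobi_density a b x)%:E)%E.
Proof.
move=> /measurable_EFinP mf; rewrite integralE [RHS]integralE.
rewrite !ge0_integral_jacobi//; last 2 first.
- exact: measurable_funeneg.
- exact: measurable_funepos.
congr (_ - _)%E; apply: eq_integral => x _.
- rewrite !funeposE muleC maxe_pMr ?lee_fin ?jacobi_density_ge0//.
  by rewrite mule0 -EFinM mulrC.
- rewrite !funenegE muleC maxe_pMr ?lee_fin ?jacobi_density_ge0//.
  by rewrite mule0 -!EFinN -EFinM mulrN mulrC.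
Qed.

Lemma jacobi_density_out (x : R) : x \notin `]-1, 1[ -> jacobi_density a b x = 0.
Proof.
move=> x1; rewrite /jacobi_density indicE memNset ?mulr0//=.
exact/negP.
Qed.

Lemma jacobi_measure_ae (P : R -> Prop) :
  (forall x, x \in `]-1, 1[ -> P x) -> {ae mu, forall x, P x}.
Proof.
move=> HP; have : mu.-negligible (~` `]-1, 1[%classic).
  apply/negligibleP; first exact: measurableC.
  rewrite /= /jacobi_measure integral0_eq// => x /= nx.
  by rewrite jacobi_density_out//; exact/negP.
by apply: negligibleS => x /= nP x1; apply/nP/HP.
Qed.

Lemma jacobi_measure_finite_set (A : set R) : finite_set A -> mu A = 0%E.
Proof.
move=> fA; have cA : countable A by exact: finite_set_countable.
have mA : measurable A by exact: countable_measurable.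
rewrite /jacobi_measure null_set_integral//.
- apply/measurable_EFinP/measurable_funTS; exact: measurable_jacobi_density.
- exact: countable_lebesgue_measure0.
Qed.

Lemma integrable_jacobi_bounded (f : R -> R) (M : R) : measurable_fun setT f ->
  (forall x, x \in `]-1, 1[ -> `|f x| <= M) ->
  mu.-integrable setT (EFin \o f).
Proof.
move=> mf fM; apply/integrableP; split; first exact/measurable_EFinP.
rewrite ge0_integral_jacobi//; last first.
  by apply: measurableT_comp => //; exact/measurable_EFinP.
apply: (@le_lt_trans _ _
    (\int[lambda]_x (`|M|%:E * (jacobi_density a b x)%:E))%E).
  apply: ge0_le_integral => //.
  - by move=> x _; rewrite mule_ge0 ?lee_fin ?jacobi_density_ge0.
  - apply: emeasurable_funM; first by apply: measurableT_comp => //; exact/measurable_EFinP.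
    by apply/measurable_EFinP; exact: measurable_jacobi_density.
  - by apply: emeasurable_funM => //; apply/measurable_EFinP; exact: measurable_jacobi_density.
  - move=> x _; have [x1|x1] := boolP (x \in `]-1, 1[).
      rewrite -!EFinM lee_fin ler_wpM2r ?jacobi_density_ge0//.
      by rewrite (le_trans (fM x x1))// ler_norm.
    by rewrite jacobi_density_out// !mule0.
rewrite ge0_integralZl//; last 2 first.
- by apply/measurable_EFinP; exact: measurable_jacobi_density.
- by move=> x _; rewrite lee_fin jacobi_density_ge0.
by have := jacobi_measureT a1 b0; rewrite /jacobi_measure => ->; rewrite mule1 ltry.
Qed.

Lemma integrable_jacobi_horner (p : {poly R}) :
  mu.-integrable setT (EFin \o horner p).
Proof.
have [M _ pM] := horner_bound p.
by apply: integrable_jacobi_bounded pM; exact: measurable_horner.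
Qed.

Definition jacobi_exp (p : {poly R}) : R := \int[mu]_x p.[x].

Lemma EFin_jacobi_exp (p : {poly R}) :
  (jacobi_exp p)%:E = (\int[mu]_x (p.[x])%:E)%E.
Proof.
by rewrite fineK//; apply: integrable_fin_num => //; exact: integrable_jacobi_horner.
Qed.

Lemma jacobi_expD : {morph jacobi_exp : p q / p + q}.
Proof.
move=> p q; rewrite /jacobi_exp -RintegralD//; try exact: integrable_jacobi_horner.
by apply: eq_Rintegral => x _; rewrite hornerD.
Qed.

Lemma jacobi_expZ (c : R) (p : {poly R}) : jacobi_exp (c *: p) = c * jacobi_exp p.
Proof.
rewrite /jacobi_exp -RintegralZl//; try exact: integrable_jacobi_horner.
by apply: eq_Rintegral => x _; rewrite hornerZ.
Qed.

Lemma jacobi_exp0 : jacobi_exp 0 = 0.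
Proof. by rewrite -[in LHS](scale0r 0) jacobi_expZ mul0r. Qed.

Lemma jacobi_exp_sum (I : Type) (s : seq I) (F : I -> {poly R}) :
  jacobi_exp (\sum_(i <- s) F i) = \sum_(i <- s) jacobi_exp (F i).
Proof. exact: (big_morph _ jacobi_expD jacobi_exp0). Qed.

Lemma jacobi_exp1 : jacobi_exp 1 = 1.
Proof.
apply: EFin_inj; rewrite EFin_jacobi_exp -[RHS](jacobi_measureT a1 b0).
under eq_integral do rewrite hornerC.
by rewrite integral_cst// mul1e.
Qed.

Lemma jacobi_exp_ge0 (p : {poly R}) :
  (forall x, x \in `]-1, 1[ -> 0 <= p.[x]) -> 0 <= jacobi_exp p.
Proof.
move=> p0; rewrite -lee_fin EFin_jacobi_exp integral_jacobi; last first.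
  exact: measurable_horner.
apply: integral_ge0 => x _; rewrite lee_fin.
have [x1|x1] := boolP (x \in `]-1, 1[).
  by rewrite mulr_ge0 ?jacobi_density_ge0 ?p0.
by rewrite jacobi_density_out// mulr0.
Qed.

(** A zero expectation would make the complement of the root set null; the root set is finite, hence
    null as well, against total mass 1. *)
Lemma jacobi_exp_sqr_gt0 (p : {poly R}) : p != 0 -> 0 < jacobi_exp (p ^+ 2).
Proof.
move=> p0; rewrite lt_neqAle jacobi_exp_ge0 ?andbT; last first.
  by move=> x _; rewrite hornerE sqr_ge0.
apply/negP => /eqP E0.
have mp : measurable_fun setT (EFin \o horner (p ^+ 2)).
  by apply/measurable_EFinP; exact: measurable_horner.
have /(ae_eq_integral_abs mu measurableT mp) :
    (\int[mu]_x `|(EFin \o horner (p ^+ 2)) x| = 0)%E.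
  transitivity (jacobi_exp (p ^+ 2))%:E; last by rewrite -E0.
  rewrite EFin_jacobi_exp; apply: eq_integral => x _ /=.
  by rewrite ger0_norm// hornerE sqr_ge0.
move=> pae; have fin0 : finite_set [set x | root p x].
  apply: contrapT => /(infinite_set_fset (size p)) [B Bp sB].
  have /allP rB : all (root p) (finmap.enum_fset B) by apply/allP => x /Bp.
  have := max_poly_roots p0 (introT allP rB) (finmap.fset_uniq B).
  by rewrite ltnNge sB.
have /negligibleP : mu.-negligible (~` [set x | root p x]).
  apply: negligibleS pae => x /= px /(_ I)/eqP; rewrite eqe hornerE expf_eq0/=.
  by move=> rx; apply: px; rewrite /= rootE.
have mroot : measurable ([set x | root p x] : set R).
  exact/countable_measurable/finite_set_countable.
move=> /(_ (measurableC mroot)) muC.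
have muT : mu setT = (mu [set x | root p x] + mu (~` [set x | root p x]))%E.
  by rewrite -(setUv [set x | root p x]) measureU//;
    [exact: measurableC|exact: setICr].
move: muT; rewrite jacobi_measureT// [X in (X + _)%E]jacobi_measure_finite_set//.
by rewrite [X in (_ + X)%E]muC adde0 => /eqP; rewrite eqe oner_eq0.
Qed.

End jacobi_exp.

(** * Pearson equation of the Jacobi weight *)

Section jacobi_pearson.
Context (R : realType) (a b : R).
Hypotheses (a1 : -1 < a) (b0 : 0 <= b).
Local Notation lambda := (@lebesgue_measure R).

(** The integrand times the density is the derivative of (1-x)^(a+1) (1+x)^(b+1) h up to
    normalization, and this primitive vanishes at both endpoints because its exponents are
    positive. *)
Lemma jacobi_pearson (h : {poly R}) :
  jacobi_exp a b ((1 - 'X ^+ 2) * h^`() + ((b - a)%:P - (a + b + 2) *: 'X) * h) = 0.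
Proof.
set q := _ + _; pose Z := jacobi_const a b.
pose f x := q.[x] * jacobi_density a b x.
pose F x := Z^-1 * ((1 - x) `^ (a + 1) * (1 + x) `^ (b + 1) * h.[x]).
have ap : 0 < a + 1 by rewrite -ltrBlDr sub0r.
have bp : 0 < b + 1 by rewrite ltr_wpDl.
have lt11 : -1 < 1 :> R by rewrite gtrN.
have dF (x : R) : x \in `]-1, 1[ -> is_derive x 1 F (f x).
  rewrite in_itv/= => /andP[x1 x2].
  have d1 := is_derive_powR_1B (a + 1) x2.
  have d2 := is_derive_powR_1D (b + 1) x1.
  have d3 := is_derive_poly h x.
  have d4 := is_deriveZ Z^-1 (is_deriveM (is_deriveM d1 d2) d3).
  apply: (is_derive_eq d4); rewrite !fctE /GRing.scale/= /f /jacobi_density -/Z.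
  rewrite indicE mem_set ?mulr1; last by rewrite /= in_itv/= x1.
  rewrite -(@mulr_powRB1 _ (1 - x) (a + 1))//; last by rewrite subr_ge0 ltW.
  rewrite -(@mulr_powRB1 _ (1 + x) (b + 1))//; last by rewrite -lerBlDl sub0r ltW.
  rewrite /q !addrK !(hornerD, hornerM, hornerN, hornerZ, hornerXn, hornerX, hornerC).
  by ring.
have intf : lambda.-integrable setT (EFin \o f).
  apply/integrableP; split.
    apply/measurable_EFinP; apply: measurable_funM; first exact: measurable_horner.
    exact: measurable_jacobi_density.
  have /integrableP[_] := integrable_jacobi_horner a1 b0 q.
  rewrite ge0_integral_jacobi//; last first.
    by apply: measurableT_comp => //; apply/measurable_EFinP; exact: measurable_horner.
  apply: le_lt_trans; rewrite le_eqVlt; apply/orP; left; apply/eqP.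
  apply: eq_integral => x _ /=.
  by rewrite normrM EFinM [in LHS](ger0_norm (jacobi_density_ge0 _ _ _)).
have fout (x : R) : x \notin `]-1, 1[ -> f x = 0.
  by move=> x1; rewrite /f jacobi_density_out// mulr0.
(* The density vanishes off the open interval, so the expectation is an integral over the closed
   interval, where [FTC2_oo] applies. *)
have -> : jacobi_exp a b q = \int[lambda]_(x in `[-1, 1]) f x.
  rewrite /jacobi_exp /Rintegral integral_jacobi; last exact: measurable_horner.
  rewrite [in RHS]integral_mkcond; congr fine; apply: eq_integral => x _.
  rewrite patchE; case: ifPn => // x1; rewrite -/(f x) fout//.
  apply: contra x1 => x1; rewrite inE /=; exact: subset_itv_oo_cc.
rewrite (@FTC2_oo _ _ F)//.
- by rewrite /F !(subrr, powR0) ?gt_eqF// !(mul0r, mulr0) subrr.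
- exact: integrableS intf.
- move=> x x11; apply: differentiable_continuous; apply/derivable1_diffP.
  have /andP[x1 x2] : -1 < x < 1 by move: x11; rewrite in_itv.
  have d1 := is_derive_powR_1B a x2.
  have d2 := is_derive_powR_1D b x1.
  have d4 := is_deriveM (is_derive_poly q x) (is_deriveZ Z^-1 (is_deriveM d1 d2)).
  have [{}d4 _] := d4; apply: near_eq_derivable d4; near=> y.
  rewrite /f /jacobi_density indicE mem_set ?mulr1//=.
  by near: y; exact: near_in_itvoo.
- split.
  + by move=> x /dF[].
  + have pow0 : (1 + x) `^ (b + 1) @[x --> (-1)^'+] --> (1 + -1) `^ (b + 1).
      rewrite subrr powR0 ?gt_eqF//.
      apply: (@increasing_cvg_at_right_comp R (fun x => 1 + x)
        (fun y => y `^ (b + 1)) (-1) +oo%O 0) => //.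
      * by move=> x y _ _; rewrite ltrD2l.
      * by apply: cvg_at_right_filter; apply: cvgD; [exact: cvg_cst|exact: cvg_id].
      * by rewrite subrr; exact: powR_cvg0.
    apply: cvgM; first exact: cvg_cst.
    apply: cvgM; last exact/cvg_at_right_filter/continuous_horner.
    apply: cvgM => //; apply: cvg_at_right_filter.
    have c1 : {for ((-1) : R), continuous (fun y : R => (1 - y) `^ (a + 1))}.
      apply/differentiable_continuous/derivable1_diffP.
      by have [] := is_derive_powR_1B (a + 1) lt11.
    exact: c1.
  + have pow0 : (1 - x) `^ (a + 1) @[x --> 1^'-] --> (1 - 1) `^ (a + 1).
      rewrite subrr powR0 ?gt_eqF//.
      apply: (@decreasing_cvg_at_left_comp R (fun x => 1 - x)
        (fun y => y `^ (a + 1)) -oo%O 1 0) => //.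
      * by move=> x y _ _; rewrite ltrD2l ltrN2.
      * by apply: cvg_at_left_filter; apply: cvgB; [exact: cvg_cst|exact: cvg_id].
      * by rewrite subrr; exact: powR_cvg0.
    apply: cvgM; first exact: cvg_cst.
    apply: cvgM; last exact/cvg_at_left_filter/continuous_horner.
    apply: cvgM => //; apply: cvg_at_left_filter.
    have c1 : {for (1 : R), continuous (fun y : R => (1 + y) `^ (b + 1))}.
      apply/differentiable_continuous/derivable1_diffP.
      by have [] := is_derive_powR_1D (b + 1) lt11.
    exact: c1.
- by move=> x /dF dFx; rewrite derive1E derive_val.
Unshelve. all: by end_near. Qed.

End jacobi_pearson.

(** * The Jacobi operator on polynomials *)

Section jacobi_operator.
Context (R : realType) (a b : R).

Definition jacobi_op (f : {poly R}) : {poly R} :=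
  (1 - 'X ^+ 2) * f^`()^`() + ((b - a)%:P - (a + b + 2) *: 'X) * f^`().

Lemma jacobi_opD (f g : {poly R}) : jacobi_op (f + g) = jacobi_op f + jacobi_op g.
Proof. by rewrite /jacobi_op !derivD; ring. Qed.

Lemma jacobi_opZ (k : R) (f : {poly R}) : jacobi_op (k *: f) = k *: jacobi_op f.
Proof. by rewrite /jacobi_op !derivZ -!scalerAr scalerDr. Qed.

Lemma jacobi_op_sum (I : Type) (s : seq I) (F : I -> {poly R}) :
  jacobi_op (\sum_(i <- s) F i) = \sum_(i <- s) jacobi_op (F i).
Proof.
by apply: (big_morph _ jacobi_opD); rewrite -[0](scale0r 0) jacobi_opZ !scale0r.
Qed.

Lemma jacobi_op1 : jacobi_op 1 = 0.
Proof. by rewrite /jacobi_op -[1]/(1%:P) derivC linear0 !mulr0 addr0. Qed.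

(** Green's formula: (L f) g - f (L g) is the Pearson expression of the Wronskian f' g - f g'. *)
Lemma jacobi_op_sym (a1 : -1 < a) (b0 : 0 <= b) (f g : {poly R}) :
  jacobi_exp a b (jacobi_op f * g) = jacobi_exp a b (f * jacobi_op g).
Proof.
apply/eqP; rewrite -subr_eq0 -[- _]mulN1r -jacobi_expZ// -jacobi_expD//.
rewrite -[X in _ == X](jacobi_pearson a1 b0 (f^`() * g - f * g^`())).
apply/eqP; congr jacobi_exp; rewrite /jacobi_op derivB !derivM scaleN1r.
by ring.
Qed.

(** The hypergeometric variable of the Jacobi polynomials; [jl_map b] is b times its value. *)
Definition half_1BX : {poly R} := 2^-1 *: (1 - 'X).

Lemma jacobi_op_half_1BX (k : nat) : jacobi_op (half_1BX ^+ k.+1) =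
  (k.+1%:R * (k.+1%:R + a)) *: half_1BX ^+ k
  - (k.+1%:R * (k.+1%:R + a + b + 1)) *: half_1BX ^+ k.+1.
Proof.
set u := half_1BX.
have h2 : 2 * (2^-1)%:P = 1 :> {poly R}.
  by rewrite -polyC_natr -polyCM mulfV ?pnatr_eq0.
have XE : 'X = 1 - 2 * u :> {poly R}.
  by rewrite /u /half_1BX -mul_polyC mulrA h2 mul1r subKr.
have du : u^`() = - (2^-1)%:P.
  rewrite /u /half_1BX derivZ derivB derivX (derivC 1) sub0r scalerN.
  by rewrite -mul_polyC mulr1.
rewrite /jacobi_op XE -!mul_polyC !(polyCD, polyCM, polyCN, polyC_natr, polyC1).
have := derivC (2^-1 : R); move: h2 du.
(* [ring] does not know that this constant polynomial inverts 2. It is therefore abstracted to [h],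
   and the difference of the two sides is exhibited as an explicit multiple of [2 * h - 1]. *)
set h := (2^-1)%:P; move: h => h h2 du dh.
case: k => [|k].
  rewrite expr1 du derivN dh expr0.
  apply/eqP; rewrite -subr_eq0; apply/eqP.
  transitivity ((2 * h - 1) * (a%:P + 1 - (a%:P + b%:P + 2) * u)); last first.
    by rewrite h2 subrr mul0r.
  ring.
rewrite deriv_exp /= du derivMn derivM derivN dh deriv_exp /= du !exprS.
apply/eqP; rewrite -subr_eq0; apply/eqP.
transitivity ((2 * h - 1) * (k.+2%:R * u ^+ k * u * ((2 * h + 1) * (1 - u) * k.+1%:R
    + (a%:P + 1 - (a%:P + b%:P + 2) * u)))); last by rewrite h2 subrr mul0r.
by ring.
Qed.

(** For equal parameters the constant part of the drift vanishes, so the operator preserves parity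
    and acts on powers of ['X^2]. *)
Lemma jacobi_op_X2 (k : nat) : b = a -> jacobi_op ('X^2 ^+ k.+1) =
  ((2 * k.+1)%:R * (2 * k + 1)%:R) *: 'X^2 ^+ k
  - ((2 * k.+1)%:R * ((2 * k.+1)%:R + a + b + 1)) *: 'X^2 ^+ k.+1.
Proof.
rewrite /jacobi_op => ->; rewrite -!exprM.
rewrite -!mul_polyC !(polyCD, polyCM, polyCN, polyC_natr, polyC1) mulnS !derivXn.
rewrite derivMn derivXn [(2 + 2 * k)%N]/= addn1 [_.-2]/= [_.-1]/=.
by rewrite !exprS; ring.
Qed.

End jacobi_operator.

(** * The orthonormal basis of Jacobi polynomials *)

Section jacobi_basis.
Context (R : realType) (a b : R).
Hypotheses (a1 : -1 < a) (b0 : 0 <= b) (ab0 : 0 < a + b + 1).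
Local Notation mu := (jacobi_measure a b).
Local Notation E := (jacobi_exp a b).
Local Notation P := (jacobi_poly a b).

Lemma pochhammerS (x : R) (k : nat) : pochhammer x k.+1 = pochhammer x k * (x + k%:R).
Proof. by rewrite /pochhammer big_ord_recr. Qed.

Lemma pochhammer_gt0 (x : R) (k : nat) : 0 < x -> 0 < pochhammer x k.
Proof. by move=> x0; apply: prodr_gt0 => i _; rewrite ltr_wpDr. Qed.

Lemma pochhammerN_eq0 (n k : nat) : (pochhammer (- n%:R : R) k == 0) = (n < k)%N.
Proof.
elim: k => [|k IH]; first by rewrite /pochhammer big_ord0 oner_eq0.
by rewrite pochhammerS mulf_eq0 IH addrC subr_eq0 eqr_nat ltnS [RHS]leq_eqVlt orbC eq_sym.
Qed.

Definition jacobi_hyp (n k : nat) : R :=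
  pochhammer (- n%:R) k * pochhammer (n%:R + a + b + 1) k
    / (pochhammer (a + 1) k * k`!%:R).

(** The ratio of consecutive 2F1 coefficients with denominators cleared: exactly the matching of
    coefficients needed in the eigenvalue equation. *)
Lemma jacobi_hypS (n k : nat) :
  jacobi_hyp n k.+1 * (k.+1%:R * (k.+1%:R + a)) =
  jacobi_hyp n k * ((k%:R - n%:R) * (k%:R + n%:R + a + b + 1)).
Proof.
have a1k : 0 < a + 1 + k%:R by move: a1 (ler0n R k) => + +; lra.
have pa : 0 < pochhammer (a + 1) k by apply: pochhammer_gt0; move: a1 => +; lra.
rewrite /jacobi_hyp !pochhammerS factS natrM -natr1; field.
by rewrite !gt_eqF//= ?ltr0n ?fact_gt0// natr1 ltr0n.
Qed.

Lemma jacobi_polyE (n : nat) : P n = (pochhammer (a + 1) n / n`!%:R) *: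
  \sum_(k < n.+1) jacobi_hyp n k *: half_1BX R ^+ k.
Proof. by []. Qed.

Lemma jacobi_op_poly (n : nat) : jacobi_op a b (P n) = jacobi_eigenvalue a b n *: P n.
Proof.
rewrite jacobi_polyE jacobi_opZ [RHS]scalerA [_ * (_ / _)]mulrC -[RHS]scalerA; congr (_ *: _).
rewrite jacobi_op_sum scaler_sumr.
under eq_bigr do rewrite jacobi_opZ.
pose u := half_1BX R.
(* The eigenvalue is (k-n)(k+n+a+b+1) - k(k+a+b+1) for every k. By [jacobi_hypS], [A k] is what the
   operator sends down from degree k+1 to degree k, and [- B k] is what it leaves in degree k; [A n]
   and [B 0] vanish. *)
pose A k := (jacobi_hyp n k * ((k%:R - n%:R) * (k%:R + n%:R + a + b + 1))) *: u ^+ k.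
pose B k := (jacobi_hyp n k * (k%:R * (k%:R + a + b + 1))) *: u ^+ k.
transitivity (\sum_(k < n.+1) (A k - B k)); last first.
  apply: eq_bigr => k _; rewrite -scalerBl scalerA; congr (_ *: _).
  by rewrite /jacobi_eigenvalue; ring.
rewrite sumrB [X in X - _]big_ord_recr [X in _ - X]big_ord_recl/=.
have -> : A n = 0 by rewrite /A subrr mul0r mulr0 scale0r.
have -> : B 0%N = 0 by rewrite /B mul0r mulr0 scale0r.
rewrite addr0 add0r -sumrB big_ord_recl expr0 jacobi_op1 scaler0 add0r.
apply: eq_bigr => k _; rewrite /bump add1n jacobi_op_half_1BX scalerBr !scalerA.
by rewrite jacobi_hypS.
Qed.

Lemma size_half_1BX : size (half_1BX R) = 2%N.
Proof.
by rewrite size_scale ?invr_eq0 ?pnatr_eq0// -opprB size_polyN -[1]/(1%:P) size_XsubC.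
Qed.

Lemma size_jacobi_poly (n : nat) : size (P n) = n.+1.
Proof.
have a10 : 0 < a + 1 by move: a1 => +; lra.
rewrite jacobi_polyE size_scale; last first.
  by rewrite mulf_neq0 ?invr_eq0 ?pnatr_eq0 -?lt0n ?fact_gt0// gt_eqF// pochhammer_gt0.
pose Q := \poly_(k < n.+1) jacobi_hyp n k.
have -> : \sum_(k < n.+1) jacobi_hyp n k *: half_1BX R ^+ k = Q \Po half_1BX R.
  rewrite /Q poly_def rmorph_sum/=; apply: eq_bigr => k _.
  by rewrite comp_polyZ comp_Xn_poly.
rewrite size_comp_poly2 ?size_half_1BX// size_poly_eq//.
rewrite /jacobi_hyp !mulf_neq0 ?invr_eq0 ?mulf_neq0 ?pochhammerN_eq0 ?ltnn//.
- by rewrite gt_eqF// pochhammer_gt0// -!addrA ltr_wpDl// addrA.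
- by rewrite gt_eqF// pochhammer_gt0.
Qed.

(** Eigenvectors of a symmetric operator; the difference of the eigenvalues factors as
    (n-m)(n+m+a+b+1), nonzero because [0 < a + b + 1]. *)
Lemma jacobi_poly_orth (m n : nat) : m != n -> E (P m * P n) = 0.
Proof.
move=> mn; have := jacobi_op_sym a1 b0 (P m) (P n).
move: (P m) (P n) (jacobi_op_poly m) (jacobi_op_poly n) => p q -> ->.
rewrite -scalerAl -scalerAr !jacobi_expZ//.
move/eqP; rewrite -subr_eq0 -mulrBl mulf_eq0 => /orP[|/eqP//].
rewrite /jacobi_eigenvalue.
rewrite (_ : _ - _ = (n%:R - m%:R) * (n%:R + m%:R + (a + b + 1))); last by ring.
rewrite mulf_eq0 subr_eq0 eqr_nat eq_sym (negbTE mn)/= gt_eqF//.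
by rewrite ltr_wpDl// addr_ge0.
Qed.

(** The element of {poly R} whose evaluation is [jacobi_onb], so that expansions can be handled
    algebraically. *)
Definition jacobi_onbp (n : nat) : {poly R} :=
  (fine ('N[mu]_2%:E [EFin \o horner (P n)])%E)^-1 *: P n.

Lemma jacobi_onbpE (n : nat) (x : R) : jacobi_onb a b n x = (jacobi_onbp n).[x].
Proof. by rewrite /jacobi_onbp hornerZ mulrC. Qed.

Lemma Lnorm2_horner (p : {poly R}) :
  ('N[mu]_2%:E [EFin \o horner p] = (Num.sqrt (E (p ^+ 2)))%:E)%E.
Proof.
rewrite unlock /Lnorm -powR12_sqrt; last first.
  by apply: jacobi_exp_ge0 => // x _; rewrite hornerE sqr_ge0.
rewrite -poweR_EFin EFin_jacobi_exp//; congr (_ `^ _)%E; apply: eq_integral => x _ /=.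
by rewrite hornerE powR_mulrn// real_normK ?num_real.
Qed.

Lemma jacobi_onbp_orth (m n : nat) : E (jacobi_onbp m * jacobi_onbp n) = (m == n)%:R.
Proof.
rewrite /jacobi_onbp -scalerAl jacobi_expZ// -scalerAr jacobi_expZ//.
have [<-|mn] := eqVneq m n; last by rewrite jacobi_poly_orth ?mulr0.
rewrite Lnorm2_horner -expr2/= mulrA -expr2 exprVn sqr_sqrtr ?mulVf//.
  by rewrite gt_eqF// jacobi_exp_sqr_gt0// -size_poly_eq0 size_jacobi_poly.
by apply: jacobi_exp_ge0 => // x _; rewrite hornerE sqr_ge0.
Qed.

(** The normalizing factor is nonzero, since otherwise the squared norm would be 0 instead of 1. *)
Lemma size_jacobi_onbp (n : nat) : size (jacobi_onbp n) = n.+1.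
Proof.
have := jacobi_onbp_orth n n; rewrite eqxx => N1.
rewrite size_scale ?size_jacobi_poly//; apply: contra_eq_neq N1 => N0.
by rewrite /jacobi_onbp N0 scale0r mul0r jacobi_exp0// eq_sym oner_eq0.
Qed.

Lemma jacobi_op_onbp (n : nat) :
  jacobi_op a b (jacobi_onbp n) = jacobi_eigenvalue a b n *: jacobi_onbp n.
Proof.
rewrite /jacobi_onbp; move: (P n) (jacobi_op_poly n) => p pE.
by rewrite jacobi_opZ pE !scalerA mulrC.
Qed.

Lemma jacobi_onbp_span (N : nat) (f : {poly R}) : (size f <= N)%N ->
  exists c : nat -> R, f = \sum_(n < N) c n *: jacobi_onbp n.
Proof.
elim: N f => [|N IH] f sf.
  exists (fun=> 0); rewrite big_ord0; apply/eqP.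
  by rewrite -size_poly_eq0 -leqn0.
pose k := f`_N / (jacobi_onbp N)`_N.
have eN0 : (jacobi_onbp N)`_N != 0.
  have := lead_coef_eq0 (jacobi_onbp N).
  by rewrite lead_coefE size_jacobi_onbp/= -size_poly_eq0 size_jacobi_onbp => ->.
have [|c fE] := IH (f - k *: jacobi_onbp N).
  apply/leq_sizeP => j; rewrite leq_eqVlt => /predU1P[<-|Nj].
    by rewrite coefB coefZ divfK ?subrr.
  rewrite coefB coefZ !nth_default ?mulr0 ?subrr//.
    by rewrite size_jacobi_onbp.
  exact: leq_trans sf _.
exists (fun n => if n == N then k else c n).
rewrite big_ord_recr/= eqxx -[LHS](subrK (k *: jacobi_onbp N)) fE; congr (_ + _).
by apply: eq_bigr => i _; rewrite ltn_eqF.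
Qed.

Lemma jacobi_coefE (f : {poly R}) (n : nat) :
  jacobi_coef a b (horner f) n = E (f * jacobi_onbp n).
Proof.
by apply: eq_Rintegral => x _; rewrite jacobi_onbpE hornerM.
Qed.

Lemma jacobi_coef_sum (N : nat) (c : nat -> R) (m : nat) :
  E ((\sum_(n < N) c n *: jacobi_onbp n) * jacobi_onbp m) =
  if (m < N)%N then c m else 0.
Proof.
rewrite mulr_suml jacobi_exp_sum//.
under eq_bigr do rewrite -scalerAl jacobi_expZ// jacobi_onbp_orth.
have [mN|Nm] := ltnP m N.
  rewrite (bigD1 (Ordinal mN))//= eqxx mulr1 big1 ?addr0// => i.
  by rewrite -val_eqE/= => /negbTE ->; rewrite mulr0.
apply: big1 => i _; rewrite ltn_eqF ?mulr0//.
exact: leq_trans (ltn_ord i) Nm.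
Qed.

Lemma jacobi_expansion (N : nat) (f : {poly R}) : (size f <= N)%N ->
  f = \sum_(n < N) E (f * jacobi_onbp n) *: jacobi_onbp n.
Proof.
move=> /jacobi_onbp_span[c fE]; rewrite {1}fE; apply: eq_bigr => i _.
by rewrite fE jacobi_coef_sum ltn_ord.
Qed.

Lemma jacobi_coef_eq0 (f : {poly R}) (n : nat) : (size f <= n)%N ->
  E (f * jacobi_onbp n) = 0.
Proof.
by move=> /jacobi_onbp_span[c ->]; rewrite jacobi_coef_sum ltnn.
Qed.

Lemma jacobi_parseval (N : nat) (f g : {poly R}) : (size f <= N)%N ->
  E (f * g) = \sum_(n < N) E (f * jacobi_onbp n) * E (g * jacobi_onbp n).
Proof.
move=> sf; rewrite {1}(jacobi_expansion sf) mulr_suml jacobi_exp_sum//.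
by apply: eq_bigr => i _; rewrite -scalerAl jacobi_expZ// [g * _]mulrC.
Qed.

End jacobi_basis.

(** * Norms in L^r *)

Section Lnorm_extra.
Context d (T : measurableType d) (R : realType).

Lemma ae_eq_Lnorm (mu : {measure set T -> \bar R}) (r : R) (f g : T -> R) :
  measurable_fun setT f -> measurable_fun setT g ->
  f = g %[ae mu] -> ('N[mu]_r%:E [EFin \o f] = 'N[mu]_r%:E [EFin \o g])%E.
Proof.
move=> mf mg fg; rewrite unlock /Lnorm; congr (_ `^ _)%E.
have mpow (h : T -> R) : measurable_fun setT h ->
    measurable_fun setT (fun x => (`|(EFin \o h) x| `^ r)%E).
  move=> mh; apply/measurable_EFinP.
  apply: (@measurableT_comp _ _ _ _ _ _ (@powR R ^~ r)) => //.
  exact: measurableT_comp.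
apply: ae_eq_integral => //; [exact: mpow|exact: mpow|].
by apply: filterS fg => x /= fgx _; rewrite fgx.
Qed.

(** Hoelder's inequality for |f|^r and the constant 1, with exponents s/r and its conjugate [t]; the
    constant has norm 1 in a probability space. *)
Lemma le_Lnorm_exponent (mu : {measure set T -> \bar R}) (r s : R) (f : T -> R) :
  mu setT = 1%E -> measurable_fun setT f -> 0 < r -> r <= s ->
  ('N[mu]_r%:E [EFin \o f] <= 'N[mu]_s%:E [EFin \o f])%E.
Proof.
move=> mu1 mf r0; rewrite le_eqVlt => /predU1P[<-//|rs].
have s0 : 0 < s by exact: lt_trans rs.
have mfr : measurable_fun setT (fun x => `|f x| `^ r).
  apply: (@measurableT_comp _ _ _ _ _ _ (@powR R ^~ r)) => //.
  exact: measurableT_comp.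
have sr0 : 0 < s / r by rewrite divr_gt0.
pose t := (1 - r / s)^-1.
have t0 : 0 < t by rewrite invr_gt0 subr_gt0 ltr_pdivrMr// mul1r.
have st : (s / r)^-1 + t^-1 = 1 by rewrite /t invrK invf_div; ring.
have := @hoelder _ _ _ mu (fun x => `|f x| `^ r) (cst 1) _ _ mfr
  (measurable_cst _) sr0 t0 st.
rewrite (_ : (_ \* cst 1) = (fun x => `|f x| `^ r)); last first.
  by apply/funext => x /=; rewrite mulr1.
rewrite -[X in (_ <= _ * X)%E -> _]/('N[mu]_t%:E[cst 1%E])%E Lnorm_cst1 mu1 poweR1r mule1.
rewrite Lnorm1 => H.
rewrite unlock /Lnorm in H *.
have {H} : (\int[mu]_x (`|f x| `^ r)%:E <=
    (\int[mu]_x (`|f x| `^ s)%:E) `^ (r / s))%E.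
  move: H; under eq_integral => x _ do rewrite /= ger0_norm ?powR_ge0//.
  under [in leRHS]eq_integral => x _ do
    rewrite /= ger0_norm ?powR_ge0// -powRrM mulrCA mulfV ?gt_eqF// mulr1.
  by rewrite invf_div.
move=> H; have ri0 : 0 <= r^-1 by rewrite invr_ge0 ltW.
have := gt0_ler_poweR ri0 _ _ H; rewrite -poweRrM mulrAC mulfV ?gt_eqF// mul1r.
apply; rewrite in_itv/= leey andbT; last exact: poweR_ge0.
by apply: integral_ge0 => x _; rewrite lee_fin powR_ge0.
Qed.

End Lnorm_extra.

(** The isometry property of the rescalings U and V, which reduces norms in the rescaled spaces to
    norms for the Jacobi measure. *)
Lemma Lnorm_pushforward (R : realType) (mu nu : {measure set R -> \bar R})
    (psi G : R -> R) (r : R) :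
  measurable_fun setT psi -> measurable_fun setT G ->
  (nu : set R -> \bar R) = pushforward mu psi ->
  ('N[nu]_r%:E [EFin \o G] = 'N[mu]_r%:E [EFin \o (G \o psi)])%E.
Proof.
move=> mpsi mG nuE; rewrite unlock /Lnorm nuE; congr (_ `^ _)%E.
rewrite ge0_integral_pushforward//; last by move=> x _; exact: poweR_ge0.
apply/measurable_EFinP.
apply: (@measurableT_comp _ _ _ _ _ _ (@powR R ^~ r)) => //.
exact: measurableT_comp.
Qed.

(** * Coefficients of powers and functional calculus on polynomials *)

Section jacobi_lower_bound.
Context (R : realType) (a b : R).
Hypotheses (a1 : -1 < a) (b0 : 0 <= b) (ab0 : 0 < a + b + 1).
Local Notation mu := (jacobi_measure a b).
Local Notation E := (jacobi_exp a b).
Local Notation e := (jacobi_onbp a b).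

Lemma jacobi_eigenvalue_lt : {homo jacobi_eigenvalue a b : m n / (m < n)%N >-> n < m}.
Proof.
move=> m n mn; rewrite /jacobi_eigenvalue ltrN2 -!addrA.
have s0 : 0 < a + (b + 1) by rewrite addrA.
rewrite ltr_pM ?ler0n ?ltr_nat ?ltrD2r ?ltr_nat//.
by rewrite addr_ge0// ltW.
Qed.

Lemma jacobi_eigenvalue0 : jacobi_eigenvalue a b 0 = 0.
Proof. by rewrite /jacobi_eigenvalue mul0r oppr0. Qed.

(** * Signs of the coefficients of powers of v *)

Section three_term.
Variables (v : {poly R}) (th d : nat -> R).
Hypotheses (th0 : th 0%N = 0) (thI : {homo th : i j / (i < j)%N >-> i < j}).
Hypothesis d0 : forall k, 0 <= d k.
Hypothesis vE : forall k, jacobi_op a b (v ^+ k.+1) = d k *: v ^+ k - th k.+1 *: v ^+ k.+1.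

Lemma jacobi_coef_rec (n k : nat) :
  (th k.+1 + jacobi_eigenvalue a b n) * E (v ^+ k.+1 * e n) = d k * E (v ^+ k * e n).
Proof.
have := jacobi_op_sym a1 b0 (v ^+ k.+1) (e n).
rewrite vE jacobi_op_onbp//; move: (e n) => p.
rewrite -[in RHS]scalerAr mulrBl -!scalerAl -[- (th _ *: _)]scaleN1r.
rewrite jacobi_expD// !jacobi_expZ//; move: (E _) (E _) => x y H.
by rewrite mulrDl -H; ring.
Qed.

Lemma jacobi_coef_exp0 (n : nat) : jacobi_eigenvalue a b n * E (v ^+ 0 * e n) = 0.
Proof.
have := jacobi_op_sym a1 b0 (v ^+ 0) (e n).
by rewrite expr0 jacobi_op1 jacobi_op_onbp// mul0r jacobi_exp0// -scalerAr jacobi_expZ.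
Qed.

(** Below the resonance [th k = - jacobi_eigenvalue a b n] the recurrence has a nonzero factor on
    the left, so the coefficient stays zero once it is zero at k = 0. It is zero there because 1 is
    orthogonal to eigenvectors of nonzero eigenvalue. *)
Lemma jacobi_coef_exp_eq0 (n k : nat) :
  th k < - jacobi_eigenvalue a b n -> E (v ^+ k * e n) = 0.
Proof.
elim: k => [|k IH] thk.
  have /eqP := jacobi_coef_exp0 n; rewrite mulf_eq0 => /orP[/eqP l0|/eqP//].
  by move: thk; rewrite th0 l0 oppr0 ltxx.
have := jacobi_coef_rec n k; rewrite IH; last by apply: lt_trans thk; exact: thI.
move/eqP; rewrite mulr0 mulf_eq0 => /orP[|/eqP//].
by rewrite addr_eq0 => /eqP thE; rewrite thE ltxx in thk.
Qed.

(* The recurrence preserves the sign from the first nonzero <v^k, e_n> on. *)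
Lemma jacobi_coef_sign (n i j : nat) : 0 <= E (v ^+ i * e n) * E (v ^+ j * e n).
Proof.
wlog ij : i j / (i <= j)%N.
  by move=> H; case/orP: (leq_total i j) => ij; [|rewrite mulrC]; exact: H.
rewrite -(subnKC ij); elim: (j - i)%N => [|k IH]; first by rewrite addn0 -expr2 sqr_ge0.
rewrite addnS; set t := th (i + k).+1; set l := jacobi_eigenvalue a b n.
(* Below the resonance the new coefficient vanishes; above it the recurrence has a positive factor
   and keeps the sign; at the resonance the coefficient of index [i], which lies strictly below,
   vanishes. *)
have [tl|lt|tl] := ltgtP t (- l).
- by rewrite [X in _ * X]jacobi_coef_exp_eq0 ?mulr0.
- have tl0 : 0 < t + l by rewrite -ltrBlDr sub0r.
  rewrite -(pmulr_rge0 _ tl0) mulrCA jacobi_coef_rec mulrCA.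
  by rewrite mulr_ge0.
- rewrite jacobi_coef_exp_eq0 ?mul0r// -/l -tl; apply: thI.
  by rewrite ltnS leq_addr.
Qed.

(** Symmetry tested against the constant 1, which the operator kills. *)
Lemma jacobi_moment_rec (k : nat) : th k.+1 * E (v ^+ k.+1) = d k * E (v ^+ k).
Proof.
have := jacobi_op_sym a1 b0 (v ^+ k.+1) 1.
rewrite jacobi_op1 mulr1 mulr0 jacobi_exp0// vE -scaleN1r.
rewrite !(jacobi_expD, jacobi_expZ)// mulN1r => /eqP.
by rewrite subr_eq0 => /eqP.
Qed.

End three_term.

Lemma powR_bounded_horner (p : {poly R}) (r : R) : 0 <= r ->
  mu.-integrable setT (EFin \o (fun x => `|p.[x]| `^ r)).
Proof.
move=> r0; have [M M0 pM] := horner_bound p.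
apply: (integrable_jacobi_bounded a1 b0 (M := M `^ r)).
  apply: (@measurableT_comp _ _ _ _ _ _ (@powR R ^~ r)) => //.
  by apply: measurableT_comp => //; exact: measurable_horner.
move=> x x1; rewrite ger0_norm ?powR_ge0//.
by apply: ge0_ler_powR; rewrite ?nnegrE// ?pM.
Qed.

Lemma horner_Lfun (p : {poly R}) (r : R) : 0 <= r ->
  horner p \in Lfun mu r%:E.
Proof.
move=> r0; rewrite inE; apply/andP; split; rewrite inE/=.
  exact: measurable_horner.
rewrite /finite_norm unlock /Lnorm poweR_lty//.
have /integrableP[_] := powR_bounded_horner p r0.
apply: le_lt_trans; rewrite le_eqVlt; apply/orP; left; apply/eqP.
by apply: eq_integral => x _ /=; rewrite [in RHS]ger0_norm ?powR_ge0.
Qed.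

Definition jacobi_calculusp (phi : R -> R) (N : nat) (f : {poly R}) : {poly R} :=
  \sum_(n < N) (phi (jacobi_eigenvalue a b n) * E (f * e n)) *: e n.

Lemma jacobi_partial_sum (phi : R -> R) (N : nat) (f : {poly R}) (x : R) :
  \sum_(n < N) phi (jacobi_eigenvalue a b n) * jacobi_coef a b (horner f) n
    * jacobi_onb a b n x = (jacobi_calculusp phi N f).[x].
Proof.
rewrite /jacobi_calculusp horner_sum; apply: eq_bigr => n _.
by rewrite hornerZ jacobi_onbpE jacobi_coefE.
Qed.

Lemma jacobi_calculusp_stable (phi : R -> R) (D N : nat) (f : {poly R}) :
  (size f <= D)%N -> (D <= N)%N -> jacobi_calculusp phi N f = jacobi_calculusp phi D f.
Proof.
move=> sf DN; rewrite /jacobi_calculusp (big_ord_widen N (fun n =>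
  (phi (jacobi_eigenvalue a b n) * E (f * e n)) *: e n) DN) [RHS]big_mkcond/=.
apply: eq_bigr => i _; case: ltnP => // Di.
by rewrite jacobi_coef_eq0 ?mulr0 ?scale0r//; exact: leq_trans Di.
Qed.

(** The spectral series of a polynomial is a finite sum, so its partial sums are eventually equal to
    [g0]. Hence [g0] is an admissible choice, [xget] does not fall back on its default, and whatever
    it selects is at L^2 distance 0 from [g0]. *)
Lemma jacobi_calculus_horner (phi : R -> R) (D : nat) (f : {poly R}) :
  (size f <= D)%N ->
  measurable_fun setT (jacobi_calculus a b phi (horner f)) /\
  jacobi_calculus a b phi (horner f) = horner (jacobi_calculusp phi D f) %[ae mu].
Proof.
move=> sf; rewrite /jacobi_calculus; set A := [set g | _].
pose g0 := horner (jacobi_calculusp phi D f).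
have SE (g : R -> R) (N : nat) : (D <= N)%N ->
    (fun x => g x - \sum_(n < N) phi (jacobi_eigenvalue a b n)
      * jacobi_coef a b (horner f) n * jacobi_onb a b n x) = (fun x => g x - g0 x).
  move=> DN; apply/funext => x.
  by rewrite jacobi_partial_sum (@jacobi_calculusp_stable _ D).
have : A (xget (cst 0) A).
  apply: xgetPex; exists g0; split; first exact: horner_Lfun.
  apply: cvg_near_cst; near=> N; rewrite SE; last by near: N; exact: nbhs_infty_ge.
  rewrite (_ : _ \o _ = cst 0%E) ?Lnorm0//.
  by apply/funext => x /=; rewrite subrr.
move: (xget _ _) => g [gL glim].
have mg : measurable_fun setT g by move: gL; rewrite inE => /andP[]; rewrite inE.
have mg0 : measurable_fun setT g0 by exact: measurable_horner.
split=> //.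
have /Lnorm_eq0_eq0 : ('N[mu]_2%:E [EFin \o (fun x => g x - g0 x)%R] = 0)%E.
  apply: (cvg_unique (@ereal_hausdorff R) _ glim).
  apply: cvg_near_cst; near=> N; rewrite SE//.
  by near: N; exact: nbhs_infty_ge.
have mB : measurable_fun setT (EFin \o (fun x => g x - g0 x)).
  by apply/measurable_EFinP; exact: measurable_funB.
move=> /(_ mB); rewrite lte_fin ltr0n => /(_ isT).
apply: filterS => x /= /[swap] _ /(_ I)/eqP.
by rewrite eqe subr_eq0 => /eqP.
Unshelve. all: by end_near. Qed.

End jacobi_lower_bound.

(** * Lower bound for the operator norm *)

Section jacobi_opnorm.
Context (R : realType) (a b : R).
Hypotheses (a1 : -1 < a) (b0 : 0 <= b) (ab0 : 0 < a + b + 1).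
Local Notation mu := (jacobi_measure a b).
Local Notation E := (jacobi_exp a b).
Local Notation e := (jacobi_onbp a b).

(** Raise the exponent from r to A/m: the integrand becomes v^A, so the norm is expressed by an
    integer moment. *)
Lemma Lnorm_horner_exp (v : {poly R}) (r : R) (m A : nat) :
  (forall x, x \in `]-1, 1[ -> 0 <= v.[x]) -> 0 < r -> (0 < m)%N ->
  r * m%:R <= A%:R ->
  ('N[mu]_r%:E [EFin \o horner (v ^+ m)] <= (E (v ^+ A) `^ (m%:R / A%:R))%:E)%E.
Proof.
move=> v0 r0 m0 rA.
have m0' : 0 < m%:R :> R by rewrite ltr0n.
have A0 : 0 < A%:R :> R by rewrite (lt_le_trans _ rA)// mulr_gt0.
apply: (@le_trans _ _ ('N[mu]_(A%:R / m%:R)%:E [EFin \o horner (v ^+ m)])%E).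
  apply: le_Lnorm_exponent => //; first exact: jacobi_measureT.
    exact: measurable_horner.
  by rewrite ler_pdivlMr.
rewrite unlock /Lnorm invf_div -poweR_EFin EFin_jacobi_exp//.
rewrite le_eqVlt; apply/orP; left; apply/eqP; congr (_ `^ _)%E.
apply: ae_eq_integral => //.
- apply/measurable_EFinP.
  apply: (@measurableT_comp _ _ _ _ _ _ (@powR R ^~ _)) => //.
  by apply: measurableT_comp => //; exact: measurable_horner.
- by apply/measurable_EFinP; exact: measurable_horner.
apply: jacobi_measure_ae => x x1 _ /=; congr EFin.
rewrite !hornerE ger0_norm ?exprn_ge0 ?v0// -!powR_mulrn ?v0// -powRrM.
by rewrite mulrCA mulfV ?gt_eqF// mulr1.
Qed.

(** * The test function v^m and duality against v^M *)

Section test_function.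
Variables (v : {poly R}) (th d : nat -> R).
Hypothesis v0 : forall x, x \in `]-1, 1[ -> 0 <= v.[x].
Hypotheses (th0 : th 0%N = 0) (thI : {homo th : i j / (i < j)%N >-> i < j}).
Hypothesis d0 : forall k, 0 <= d k.
Hypothesis vE : forall k,
  jacobi_op a b (v ^+ k.+1) = d k *: v ^+ k - th k.+1 *: v ^+ k.+1.
Variables (phi : R -> R) (D : nat) (c : R) (m M : nat).
Hypothesis phic : forall n, (n <= D)%N -> c <= phi (jacobi_eigenvalue a b n).
Hypothesis sv : (size (v ^+ m) <= D.+1)%N.

(** In the Parseval sums the products of coefficients are nonnegative by [jacobi_coef_sign], so each
    multiplier may be replaced by its lower bound [c]. *)
Lemma jacobi_calculusp_ge :
  c * E (v ^+ (m + M)) <= E (jacobi_calculusp a b phi D.+1 (v ^+ m) * v ^+ M).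
Proof.
rewrite exprD (jacobi_parseval a1 b0 ab0 _ sv) mulr_sumr mulr_suml jacobi_exp_sum//.
apply: ler_sum => n _; rewrite -scalerAl jacobi_expZ// [e n * _]mulrC -[leRHS]mulrA.
apply: ler_wpM2r; first exact: jacobi_coef_sign th0 thI d0 vE _ _ _.
by apply: phic; rewrite -ltnS.
Qed.

Variables (p q : R) (A : nat).
Hypotheses (p1 : 1 < p) (q1 : 1 < q) (m0 : (0 < m)%N) (M0 : (0 < M)%N).
Hypotheses (pmA : p * m%:R <= A%:R) (qmM : (m + M)%:R <= q * m%:R).
Hypotheses (EA : E (v ^+ A) = 1) (EB : 0 < E (v ^+ (m + M))).

(** Hoelder's inequality bounds the pairing of [jacobi_calculusp_ge] by the L^q norm times the dual
    norm of v^M; dividing by the latter leaves the power m/(m+M) of the moment. *)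
Lemma Lnorm_jacobi_calculus_ge :
  ((c * E (v ^+ (m + M)) `^ (m%:R / (m + M)%:R))%:E <=
   'N[mu]_q%:E [EFin \o jacobi_calculus a b phi (horner (v ^+ m))])%E.
Proof.
have [mS SE] := jacobi_calculus_horner a1 b0 ab0 phi sv.
rewrite (ae_eq_Lnorm _ mS (@measurable_horner R _ setT) SE).
set g := jacobi_calculusp _ _ _ _ _.
have q0 : 0 < q by exact: lt_trans q1.
pose q' := (1 - q^-1)^-1.
have q'0 : 0 < q' by rewrite invr_gt0 subr_gt0 invf_lt1.
have qq' : q^-1 + q'^-1 = 1 by rewrite /q' invrK; ring.
have := @hoelder _ _ _ mu (horner g) (horner (v ^+ M)) q q'
  (@measurable_horner R _ setT) (@measurable_horner R _ setT) q0 q'0 qq'.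
have m0' : 0 < m%:R :> R by rewrite ltr0n.
have M0' : 0 < M%:R :> R by rewrite ltr0n.
(* This is [qmM] rewritten for the conjugate exponent; it lets [Lnorm_horner_exp] control the dual
   norm of v^M by the moment of order m + M. *)
have q'M : q' * M%:R <= (m + M)%:R.
  rewrite mulrC /q' ler_pdivrMr ?subr_gt0 ?invf_lt1//.
  have : (m + M)%:R / q <= m%:R by rewrite ler_pdivrMr// mulrC.
  by rewrite mulrBr mulr1 natrD => ?; lra.
have := Lnorm_horner_exp v0 q'0 M0 q'M.
have X0 := EB; set X := E (v ^+ (m + M)) in X0 *; set N := ('N[mu]_q%:E[_])%E.
move=> HM HH.
have : ((c * X)%:E <= N * (X `^ (M%:R / (m + M)%:R))%:E)%E.
  apply: (@le_trans _ _ ('N[mu]_1[EFin \o (horner g \* horner (v ^+ M))%R])%E).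
    apply: (@le_trans _ _ (E (g * v ^+ M))%:E).
      by rewrite lee_fin; exact: jacobi_calculusp_ge.
    rewrite Lnorm1 EFin_jacobi_exp// (le_trans (lee_abs _))//.
    rewrite (le_trans (le_abse_integral _ _ _))//.
      by apply/measurable_EFinP; exact: measurable_horner.
    rewrite le_eqVlt; apply/orP; left; apply/eqP; apply: eq_integral => x _ /=.
    by rewrite hornerM.
  by apply: (le_trans HH); rewrite lee_wpmul2l// Lnorm_ge0.
have XM : 0 < X `^ (M%:R / (m + M)%:R) by rewrite powR_gt0.
rewrite -lee_pdivrMr// -EFinM; apply: le_trans; rewrite lee_fin -mulrA.
rewrite le_eqVlt; apply/orP; left; apply/eqP; congr (_ * _).
apply: (mulIf (lt0r_neq0 XM)); rewrite divfK ?gt_eqF// -powRD;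
  last by rewrite (gt_eqF X0) implybT.
rewrite -mulrDl -natrD divff ?powRr1 ?ltW//.
by rewrite pnatr_eq0 -lt0n addn_gt0 m0.
Qed.

(** The normalization [EA] and [pmA] give v^m an L^p norm at most 1, so v^m read in the rescaled
    variable competes in the supremum. *)
Lemma opnorm_ge_normalized (nu : {measure set R -> \bar R}) (psi chi : R -> R) :
  measurable_fun setT psi -> measurable_fun setT chi -> cancel psi chi ->
  (nu : set R -> \bar R) = pushforward mu psi ->
  ((c * E (v ^+ (m + M)) `^ (m%:R / (m + M)%:R))%:E <=
   opnorm nu p q (fun F => jacobi_calculus a b phi (F \o psi) \o chi))%E.
Proof.
move=> mpsi mchi psiK nuE; pose f := horner (v ^+ m).
have [mS _] := jacobi_calculus_horner a1 b0 ab0 phi sv.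
have mf : measurable_fun setT f by exact: measurable_horner.
have mF : measurable_fun setT (f \o chi) by exact: measurableT_comp.
have FE : (f \o chi) \o psi = f by apply/funext => x /=; rewrite psiK.
apply: (le_trans Lnorm_jacobi_calculus_ge); apply: ereal_sup_ubound.
exists (f \o chi); last first.
  rewrite (Lnorm_pushforward _ mpsi _ nuE) ?FE; last exact: measurableT_comp.
  by apply: eq_Lnorm => x /=; rewrite psiK.
split; last first.
  rewrite (Lnorm_pushforward _ mpsi mF nuE) FE.
  have p0 : 0 < p by exact: lt_trans p1.
  by apply: (le_trans (Lnorm_horner_exp v0 p0 m0 pmA)); rewrite EA powR1.
have := horner_Lfun a1 b0 (v ^+ m) (ler0n R 2).
rewrite !inE => /andP[]; rewrite !inE/= => _ fin_f.
apply/andP; split; rewrite inE//=.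
by move: fin_f; rewrite /finite_norm (Lnorm_pushforward _ mpsi mF nuE) FE.
Qed.

End test_function.

Lemma opnorm_ge (v : {poly R}) (th d : nat -> R) (phi : R -> R) (D : nat) (c : R)
    (m M : nat) (p q : R) (A : nat)
    (nu : {measure set R -> \bar R}) (psi chi : R -> R) :
  (forall x, x \in `]-1, 1[ -> 0 <= v.[x]) ->
  th 0%N = 0 -> {homo th : i j / (i < j)%N >-> i < j} -> (forall k, 0 <= d k) ->
  (forall k, jacobi_op a b (v ^+ k.+1) = d k *: v ^+ k - th k.+1 *: v ^+ k.+1) ->
  (forall n, (n <= D)%N -> c <= phi (jacobi_eigenvalue a b n)) ->
  (size (v ^+ m) <= D.+1)%N ->
  1 < p -> 1 < q -> (0 < m)%N -> (0 < M)%N ->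
  p * m%:R <= A%:R -> (m + M)%:R <= q * m%:R ->
  0 < E (v ^+ A) -> 0 < E (v ^+ (m + M)) ->
  measurable_fun setT psi -> measurable_fun setT chi -> cancel psi chi ->
  (nu : set R -> \bar R) = pushforward mu psi ->
  ((c * (E (v ^+ (m + M)) `^ (m%:R / (m + M)%:R) / E (v ^+ A) `^ (m%:R / A%:R)))%:E <=
   opnorm nu p q (fun F => jacobi_calculus a b phi (F \o psi) \o chi))%E.
Proof.
move=> v0 th0 thI d0 vE phic sv p1 q1 m0 M0 pmA qmM EA EB mpsi mchi psiK nuE.
have A0 : 0 < A%:R :> R.
  by rewrite (lt_le_trans _ pmA)// mulr_gt0 ?ltr0n// (lt_trans _ p1).
(* The three-term hypothesis is stable under scaling: k v has E (k v)^A = 1. *)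
pose k := E (v ^+ A) `^ (- A%:R^-1).
have k0 : 0 < k by rewrite powR_gt0.
have EkA n : E ((k *: v) ^+ n) = k ^+ n * E (v ^+ n) by rewrite exprZn jacobi_expZ.
have := @opnorm_ge_normalized (k *: v) th (fun i => k * d i) _ th0 thI _ _ phi D c m M
  phic _ p q A p1 q1 m0 M0 pmA qmM _ _ nu psi chi mpsi mchi psiK nuE.
rewrite !EkA (_ : c * _ =
    c * (E (v ^+ (m + M)) `^ (m%:R / (m + M)%:R) / E (v ^+ A) `^ (m%:R / A%:R))).
  apply.
  - by move=> x x1; rewrite hornerZ mulr_ge0 ?v0// ltW.
  - by move=> i; rewrite mulr_ge0// ltW.
  - move=> i; rewrite !exprZn jacobi_opZ vE scalerBr !scalerA exprS.
    by congr (_ *: _ - _ *: _); ring.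
  - by rewrite exprZn (leq_trans (size_scale_leq _ _)).
  - rewrite /k -powR_mulrn ?powR_ge0// -powRrM mulNr mulVf ?gt_eqF//.
    by rewrite powRN powRr1 ?ltW// mulVf ?gt_eqF.
  - by rewrite mulr_gt0// exprn_gt0.
congr (_ * _); rewrite powRM ?exprn_ge0 ?ltW//; rewrite mulrC; congr (_ * _).
rewrite -powR_mulrn ?ltW// -powRrM mulrCA mulfV ?pnatr_eq0 -?lt0n ?addn_gt0 ?m0//.
by rewrite mulr1 /k -powRrM mulNr powRN mulrC.
Qed.

End jacobi_opnorm.

(** * Asymptotics of Pochhammer symbols *)

Section pochhammer_asymptotics.
Context (R : realType).
Implicit Types c p q t K : R.

Lemma pochhammerD_ge c (A n : nat) : 0 < c ->
  pochhammer c A * (c + A%:R) ^+ n <= pochhammer c (A + n).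
Proof.
move=> c0; elim: n => [|n IH]; first by rewrite expr0 mulr1 addn0.
rewrite addnS pochhammerS exprSr mulrA.
have cA : 0 <= c + A%:R by rewrite addr_ge0// ltW.
apply: ler_pM => //.
  by rewrite mulr_ge0 ?exprn_ge0// ltW// pochhammer_gt0.
by rewrite lerD2l ler_nat leq_addr.
Qed.

Lemma pochhammerD_le c (A n : nat) : 0 < c ->
  pochhammer c (A + n) <= pochhammer c A * (c + (A + n)%:R) ^+ n.
Proof.
move=> c0; elim: n => [|n IH]; first by rewrite expr0 mulr1 addn0.
have cA k : 0 <= c + k%:R by rewrite addr_ge0// ltW.
have cle : c + (A + n)%:R <= c + (A + n.+1)%:R.
  by rewrite lerD2l ler_nat leq_add2l.
rewrite addnS pochhammerS -addnS exprSr mulrA.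
apply: ler_pM => //; first by rewrite ltW// pochhammer_gt0.
apply: (le_trans IH); rewrite ler_wpM2l//; first by rewrite ltW// pochhammer_gt0.
by apply: lerXn2r; rewrite ?nnegrE.
Qed.

(* The first h factors are at most c + h <= 3/4 (c + 2h). *)
Lemma pochhammer_double_le c (h : nat) : 0 < c -> c <= (h + h)%:R ->
  pochhammer c (h + h) <= (3 / 4) ^+ h * (c + (h + h)%:R) ^+ (h + h).
Proof.
move=> c0 ch; have cA k : 0 <= c + k%:R by rewrite addr_ge0// ltW.
apply: (le_trans (pochhammerD_le _ _ c0)).
rewrite exprD mulrA; apply: ler_wpM2r; first by rewrite exprn_ge0.
have := pochhammerD_le 0 h c0; rewrite !add0n {2}/pochhammer big_ord0 mul1r.
move/le_trans; apply; rewrite -exprMn; apply: lerXn2r; rewrite ?nnegrE//.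
  by rewrite mulr_ge0 ?divr_ge0.
by move: ch; rewrite natrD; lra.
Qed.

(** Write x = (c)_A with A = 2h, and y = c + A. The factors beyond A are at least y, so (c)_B is at
    least x y^(B-A), while x is at most (3/4)^h y^A. With e = m(B-A)/B, the quotient is thus at
    least y^e / x^(e/A), hence at least (4/3)^(e/2). *)
Lemma pochhammer_root_ratio c (h B m : nat) : 0 < c -> c <= (h + h)%:R ->
  (h + h <= B)%N -> (0 < h)%N ->
  (4 / 3) `^ ((m * (B - (h + h)))%:R / (2 * B%:R)) <=
  pochhammer c B `^ (m%:R / B%:R) / pochhammer c (h + h) `^ (m%:R / (h + h)%:R).
Proof.
move=> c0 ch hB h0.
have A0 : (0 < h + h)%N by rewrite addn_gt0 h0.
have B0 : (0 < B)%N by exact: leq_trans hB.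
have A0' : 0 < (h + h)%:R :> R by rewrite ltr0n.
have B0' : 0 < B%:R :> R by rewrite ltr0n.
have xle := pochhammer_double_le c0 ch.
have Bge := pochhammerD_ge (h + h) (B - (h + h)) c0.
rewrite subnKC// in Bge.
have x0 := pochhammer_gt0 (h + h) c0.
have y0 : 0 < c + (h + h)%:R by rewrite ltr_pwDl.
set x := pochhammer c (h + h) in x0 xle Bge *; set y := c + _ in y0 xle Bge *.
set A := (h + h)%N in A0 A0' hB xle Bge *.
pose e : R := (m * (B - A))%:R / B%:R.
have e0 : 0 <= e by rewrite divr_ge0.
have eE : (B - A)%:R * (m%:R / B%:R) = e by rewrite /e natrM mulrA [_%:R * m%:R]mulrC.
have eA : m%:R / A%:R - m%:R / B%:R = e / A%:R.
  by rewrite /e natrM natrB//; field; rewrite !gt_eqF.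
have [x0w y0w] : 0 <= x /\ 0 <= y by rewrite !ltW.
rewrite ler_pdivlMr ?powR_gt0//.
apply: (@le_trans _ _ ((x * y ^+ (B - A)) `^ (m%:R / B%:R))); last first.
  apply: ge0_ler_powR.
  - by rewrite divr_ge0.
  - by rewrite nnegrE mulr_ge0 ?exprn_ge0 ?ltW.
  - by rewrite nnegrE ltW// pochhammer_gt0.
  - exact: Bge.
rewrite powRM ?exprn_ge0// -[y ^+ _]powR_mulrn// -[(y `^ _) `^ _]powRrM eE.
rewrite -(subrK (m%:R / B%:R) (m%:R / A%:R)) eA powRD ?(gt_eqF x0) ?implybT//.
rewrite [leLHS]mulrA [leLHS]mulrC ler_pM2l ?powR_gt0//.
have xe : x `^ (e / A%:R) <= (3 / 4) `^ (e / 2) * y `^ e.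
  apply: (@le_trans _ _ (((3 / 4) ^+ h * y ^+ A) `^ (e / A%:R))).
    apply: ge0_ler_powR.
    - by rewrite divr_ge0.
    - by rewrite nnegrE ltW.
    - by rewrite nnegrE mulr_ge0 ?exprn_ge0 ?divr_ge0 ?ltW.
    - exact: xle.
  rewrite powRM ?exprn_ge0 ?divr_ge0//.
  rewrite -!powR_mulrn ?divr_ge0// -!powRrM.
  rewrite (_ : h%:R * (e / A%:R) = e / 2); last first.
    by rewrite /A natrD; field; rewrite -natrD gt_eqF.
  by rewrite (_ : A%:R * (e / A%:R) = e)// mulrCA mulfV ?mulr1// gt_eqF.
apply: (le_trans (ler_wpM2l (powR_ge0 _ _) xe)).
rewrite mulrA (_ : _ / (2 * B%:R) = e / 2); last first.
  by rewrite /e; field; rewrite gt_eqF.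
rewrite -powRM ?divr_ge0// (_ : 4 / 3 * (3 / 4) = 1); last by field.
by rewrite powR1 mul1r.
Qed.

Lemma bernoulli_ineq (x : R) (n : nat) : 0 <= x -> x <= 1 -> 1 - n%:R * x <= (1 - x) ^+ n.
Proof.
move=> x0 x1; elim: n => [|n IH]; first by rewrite expr0 mul0r subr0.
rewrite exprSr; apply: (@le_trans _ _ ((1 - n%:R * x) * (1 - x))); last first.
  by rewrite ler_wpM2r ?subr_ge0.
have : 0 <= n%:R * x * x by rewrite !mulr_ge0.
by rewrite -natr1; lra.
Qed.

(** Meant for the large denominator parameter of the moments. All factors lie between c and c + B,
    so the quotient is at least (c/(c+B))^m, and Bernoulli's inequality bounds this by 1 -
    mB/(c+B). *)
Lemma pochhammer_root_ratio_shift c (A B m : nat) : 0 < c -> (0 < A)%N -> (0 < B)%N ->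
  (2 * m * B)%:R <= c ->
  2^-1 <= pochhammer c A `^ (m%:R / A%:R) / pochhammer c B `^ (m%:R / B%:R).
Proof.
move=> c0 A0 B0 cB.
have A0' : 0 < A%:R :> R by rewrite ltr0n.
have B0' : 0 < B%:R :> R by rewrite ltr0n.
rewrite ler_pdivlMr ?powR_gt0 ?pochhammer_gt0//.
have root (z : R) (n : nat) : 0 <= z -> (0 < n)%N -> (z ^+ n) `^ (m%:R / n%:R) = z ^+ m.
  move=> z0 n0; rewrite -!powR_mulrn// -powRrM mulrCA mulfV ?mulr1//.
  by rewrite pnatr_eq0 -lt0n.
have cB0 : 0 <= c + B%:R by rewrite addr_ge0// ltW.
apply: (@le_trans _ _ (2^-1 * (c + B%:R) ^+ m)).
  rewrite ler_pM2l ?invr_gt0// -(root _ B)//; apply: ge0_ler_powR.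
  - by rewrite divr_ge0.
  - by rewrite nnegrE ltW// pochhammer_gt0.
  - by rewrite nnegrE exprn_ge0.
  - by have := pochhammerD_le 0 B c0; rewrite !add0n {2}/pochhammer big_ord0 mul1r.
apply: (@le_trans _ _ (c ^+ m)); last first.
  rewrite -(root _ A (ltW c0) A0); apply: ge0_ler_powR.
  - by rewrite divr_ge0.
  - by rewrite nnegrE exprn_ge0 ?ltW.
  - by rewrite nnegrE ltW// pochhammer_gt0.
  - have := pochhammerD_ge 0 A c0.
    by rewrite !add0n {1}/pochhammer big_ord0 mul1r addr0.
rewrite -ler_pdivlMl ?invr_gt0// invrK.
have cB' : 0 < c + B%:R by rewrite ltr_pwDl.
have := @bernoulli_ineq (B%:R / (c + B%:R)) m.
rewrite divr_ge0// ler_pdivrMr// mul1r lerDr ltW// => /(_ isT isT).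
rewrite (_ : 1 - _ / _ = c / (c + B%:R)); last by field; rewrite gt_eqF.
rewrite exprMn exprVn ler_pdivlMr ?exprn_gt0// => H.
have : 2^-1 * (c + B%:R) ^+ m <= c ^+ m.
  apply: le_trans H; rewrite ler_wpM2r ?exprn_ge0//.
  rewrite mulrA lerBrDr -lerBrDl ler_pdivrMr//.
  move: cB; rewrite !natrM => cB.
  have : 0 <= B%:R :> R by []. nra.
by move=> H2; lra.
Qed.

Lemma test_parameters p q t c K : 1 < p -> p < q -> 0 < c ->
  exists m M A : nat, [/\ (0 < m)%N, (0 < M)%N, p * m%:R <= A%:R,
    (m + M)%:R <= q * m%:R &
    K <= expR (- t * Num.sqrt (4 * m%:R)) *
      (pochhammer c (m + M) `^ (m%:R / (m + M)%:R) / pochhammer c A `^ (m%:R / A%:R))].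
Proof.
move=> p1 pq c0.
have qp0 : 0 < q - p by rewrite subr_gt0.
have p0 : 0 < p by exact: lt_trans p1.
(* The gap (q-p) m0 > 2 leaves room for two consecutive integers [a0] and [a0.+1] between p m0 and q
   m0; after scaling they give the moment orders A and B = m + M. *)
pose m0 := (Num.truncn (2 / (q - p))).+1.
have m0q : 2 < (q - p) * m0%:R by rewrite mulrC -ltr_pdivrMr// truncnS_gt.
pose a0 := (Num.truncn (p * m0%:R)).+1.
have /andP[a0p pa0] : p * m0%:R < a0%:R <= p * m0%:R + 1.
  rewrite truncnS_gt -natr1 lerD2r.
  by have /truncn_itv/andP[] : 0 <= p * m0%:R by rewrite mulr_ge0// ltW.
pose L : R := ln (4 / 3) * (m0%:R / a0.+1%:R).
have L0 : 0 < L by rewrite mulr_gt0 ?divr_gt0 ?ltr0n// ln_gt0//; lra.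
pose T := t * Num.sqrt (8 * m0%:R).
(* The final exponent is N (L N - T), where [L] is the rate of gain and [T] comes from the
   multiplier. Beyond (T + 1)/L it is at least N; beyond K this suffices for the bound, and beyond c
   it secures c <= A. *)
pose N := (Num.truncn (`|(T + 1) / L| + `|K| + `|c|)).+1.
have NS : `|(T + 1) / L| + `|K| + `|c| < N%:R by exact: truncnS_gt.
have NT : (T + 1) / L < N%:R.
  move: NS (ler_norm ((T + 1) / L)) (normr_ge0 K) (normr_ge0 c).
  by move: (_ / L) `|_ / L| => x y; lra.
have [NK Nc] : K < N%:R /\ c < N%:R.
  move: NS (ler_norm K) (ler_norm c) (normr_ge0 ((T + 1) / L)) (normr_ge0 K) (normr_ge0 c).
  by move: (`|_ / L|) => x; split; lra.
(* A square, so that sqrt (4 m) is linear in N while the gain exponent is quadratic. *)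
pose j := (N * N)%N.
have jN : (N <= j)%N by rewrite /j leq_pmulr.
have j0 : (0 < j)%N by exact: leq_trans jN.
have j0' : 0 < j%:R :> R by rewrite ltr0n.
(* The factor 2 makes A = h + h even, as [pochhammer_double_le] requires. *)
pose m := (2 * m0 * j)%N; pose h := (a0 * j)%N; pose B := (2 * a0.+1 * j)%N.
have m_gt0 : (0 < m)%N by rewrite !muln_gt0.
have AE : (h + h = 2 * a0 * j)%N by rewrite /h addnn -mul2n mulnA.
have pmA : p * m%:R <= (h + h)%:R.
  rewrite AE /m -!mulnA !natrM; nra.
have BAE : (B - (h + h) = 2 * j)%N.
  by rewrite AE /B -mulnBl -mulnBr subSnn.
have Bqm : B%:R <= q * m%:R.
  rewrite /B /m -!mulnA !natrM -natr1; nra.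
have AB : (h + h <= B)%N by rewrite AE /B leq_pmul2r// leq_pmul2l.
have mB : (m < B)%N.
  rewrite -(ltr_nat R); apply: lt_le_trans (_ : (h + h)%:R <= _); last by rewrite ler_nat.
  by apply: lt_le_trans pmA; rewrite ltr_pMl// ltr0n.
exists m, (B - m)%N, (h + h)%N; split=> //.
- by rewrite subn_gt0.
- by rewrite subnKC// ltnW.
rewrite subnKC ?(ltnW mB)//.
have cA : c <= (h + h)%:R.
  apply: (le_trans (ltW Nc)); rewrite ler_nat AE (leq_trans jN)//.
  by rewrite leq_pmull// muln_gt0.
have h0 : (0 < h)%N by rewrite muln_gt0 j0.
have B0 : (0 < B)%N by exact: leq_ltn_trans mB.
apply: (@le_trans _ _ (expR (- t * Num.sqrt (4 * m%:R)) *
    (4 / 3) `^ ((m * (B - (h + h)))%:R / (2 * B%:R)))); last first.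
  by rewrite ler_wpM2l ?expR_ge0//; exact: pochhammer_root_ratio.
have -> : (m * (B - (h + h)))%:R / (2 * B%:R) = m0%:R / a0.+1%:R * j%:R :> R.
  by rewrite BAE /m /B !natrM; field; rewrite !gt_eqF ?ltr0n.
have -> : Num.sqrt (4 * m%:R) = Num.sqrt (8 * m0%:R) * N%:R :> R.
  rewrite (_ : 4 * m%:R = 8 * m0%:R * N%:R ^+ 2); last first.
    by rewrite /m /j !natrM; ring.
  by rewrite sqrtrM ?sqrtr_sqr ?normr_nat// mulr_ge0.
rewrite /powR gt_eqF// -expRD.
apply: (le_trans (ltW NK)); apply: (@le_trans _ _ (1 + N%:R)); first by rewrite lerDr.
apply: (le_trans (expR_ge1Dx _)); rewrite ler_expR.
rewrite (_ : _ + _ = N%:R * (L * N%:R - T)); last first.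
  by rewrite /T /L /j natrM; ring.
rewrite ler_peMr// lerBrDr addrC -ler_pdivrMl// mulrC; exact: ltW.
Qed.

End pochhammer_asymptotics.

(** * Conclusion *)

(** These are the moments of the Beta law with parameters c and s - c; the relation between [d] and
    [th] turns [jacobi_moment_rec] into the ratio (c+k)/(s+k). *)
Lemma jacobi_moment (R : realType) (a b : R) (v : {poly R}) (th d : nat -> R) (c s : R) :
  -1 < a -> 0 <= b -> 0 < c -> 0 < s -> (forall k, 0 < th k.+1) ->
  (forall k, jacobi_op a b (v ^+ k.+1) = d k *: v ^+ k - th k.+1 *: v ^+ k.+1) ->
  (forall k, d k * (s + k%:R) = th k.+1 * (c + k%:R)) ->
  forall k, jacobi_exp a b (v ^+ k) = pochhammer c k / pochhammer s k.
Proof.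
move=> a1 b0 c0 s0 th0 vE dE; elim=> [|k IH].
  by rewrite expr0 jacobi_exp1// /pochhammer !big_ord0 divr1.
have sk : s + k%:R != 0 by rewrite gt_eqF// ltr_pwDl.
apply: (mulfI (lt0r_neq0 (th0 k))).
rewrite (jacobi_moment_rec a1 b0 vE) IH !pochhammerS.
rewrite (_ : d k = th k.+1 * (c + k%:R) / (s + k%:R)); last by rewrite -dE mulfK.
by field; rewrite sk gt_eqF// pochhammer_gt0.
Qed.

(** The numerators (c)_k of the moments carry the gain and do not depend on the scaling parameter.
    The denominators (s)_k cost only the factor 1/2 once s is at least 2m(m+M). *)
Lemma opnorm_ge_pochhammer (R : realType) (a b : R) (v : {poly R}) (th d : nat -> R)
    (c s : R) (phi : R -> R) (r m M A : nat) (p q C : R)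
    (nu : {measure set R -> \bar R}) (psi chi : R -> R) :
  -1 < a -> 0 <= b -> 0 < a + b + 1 -> 0 < c -> 0 < s ->
  (forall x, x \in `]-1, 1[ -> 0 <= v.[x]) -> (size v <= r.+1)%N ->
  th 0%N = 0 -> {homo th : i j / (i < j)%N >-> i < j} -> (forall k, 0 <= d k) ->
  (forall k, jacobi_op a b (v ^+ k.+1) = d k *: v ^+ k - th k.+1 *: v ^+ k.+1) ->
  (forall k, d k * (s + k%:R) = th k.+1 * (c + k%:R)) ->
  0 <= C -> (forall n, (n <= r * m)%N -> C <= phi (jacobi_eigenvalue a b n)) ->
  1 < p -> 1 < q -> (0 < m)%N -> (0 < M)%N ->
  p * m%:R <= A%:R -> (m + M)%:R <= q * m%:R -> (2 * m * (m + M))%:R <= s ->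
  measurable_fun setT psi -> measurable_fun setT chi -> cancel psi chi ->
  (nu : set R -> \bar R) = pushforward (jacobi_measure a b) psi ->
  ((C * (pochhammer c (m + M) `^ (m%:R / (m + M)%:R)
         / pochhammer c A `^ (m%:R / A%:R)) / 2)%:E <=
   opnorm nu p q (fun F => jacobi_calculus a b phi (F \o psi) \o chi))%E.
Proof.
move=> a1 b0 ab0 c0 s0 v0 sv th0 thI d0 vE dE C0 phiC p1 q1 m0 M0 pmA qmM sB
  mpsi mchi psiK nuE.
have thp k : 0 < th k.+1 by rewrite -th0; exact: thI.
have vk := jacobi_moment a1 b0 c0 s0 thp vE dE.
have vk0 k : 0 < jacobi_exp a b (v ^+ k) by rewrite vk divr_gt0// pochhammer_gt0.
have svm : (size (v ^+ m) <= (r * m).+1)%N.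
  rewrite (leq_trans (size_poly_exp_leq _ _))// ltnS leq_pmul2r//.
  by rewrite -subn1 leq_subLR add1n.
have := opnorm_ge a1 b0 ab0 v0 th0 thI d0 vE phiC svm p1 q1 m0 M0 pmA qmM
  (vk0 A) (vk0 (m + M)%N) mpsi mchi psiK nuE.
apply: le_trans; rewrite lee_fin -mulrA ler_wpM2l//.
have A0 : (0 < A)%N.
  by rewrite -(ltr_nat R) (lt_le_trans _ pmA)// mulr_gt0 ?ltr0n// (lt_trans _ p1).
have B0 : (0 < m + M)%N by rewrite addn_gt0 m0.
have := pochhammer_root_ratio_shift s0 A0 B0 sB.
have pw (z x y : R) : 0 < x -> 0 < y -> (x / y) `^ z = x `^ z / y `^ z.
  move=> x0 y0; rewrite powRM ?invr_ge0 ?(ltW x0) ?(ltW y0)//.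
  by rewrite -[y^-1]powR_inv1 ?(ltW y0)// -powRrM mulN1r powRN.
rewrite !vk !pw ?pochhammer_gt0//.
have pp z n y : 0 < y -> 0 < (pochhammer y n : R) `^ z.
  by move=> y0; rewrite powR_gt0// pochhammer_gt0.
move: (pp (m%:R / (m + M)%:R) (m + M)%N _ c0) (pp (m%:R / A%:R) A _ c0).
move: (pp (m%:R / (m + M)%:R) (m + M)%N _ s0) (pp (m%:R / A%:R) A _ s0).
move: (_ `^ _) (_ `^ _) (_ `^ _) (_ `^ _) => w x y z w0 x0 y0 z0 xw.
rewrite (_ : x / z / (w / y) = x / w * (y / z)); last by field; rewrite !gt_eqF.
by rewrite ler_wpM2l// divr_ge0 ?ltW.
Qed.

(** An eigenvalue growing at most linearly in the scaling parameter [w] is compensated by the time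
    change, giving a bound free of [w]. *)
Lemma poisson_multiplier_ge (R : realType) (t w x y : R) : 0 <= t -> 0 < w -> x <= y * w ->
  expR (- t * Num.sqrt y) <= expR (- (t / Num.sqrt w) * Num.sqrt x).
Proof.
move=> t0 w0 xyw; have sw0 : 0 < Num.sqrt w by rewrite sqrtr_gt0.
rewrite ler_expR !mulNr lerN2 mulrAC -mulrA ler_wpM2l// ler_pdivrMr//.
(* For negative y also x is nonpositive, and [Num.sqrt] takes the value 0 there. *)
have [y0|y0] := leP 0 y; first by rewrite -sqrtrM// ler_wsqrtr.
by rewrite ler0_sqrtr ?mulr_ge0// (le_trans xyw)// pmulr_lle0// ltW.
Qed.

Lemma cvgy_jl_opnorm (R : realType) (a p q t : R) :
  -1 < a -> 1 < p -> p < q -> 0 <= t ->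
  opnorm (jl_measure a b) p q (jl_poisson a b t) @[b --> +oo%R] --> +oo%E.
Proof.
move=> a1 p1 pq t0; have q1 : 1 < q by exact: lt_trans pq.
have c0 : 0 < a + 1 by rewrite -ltrBlDr sub0r.
apply/cvgeyPge => K.
(* The degrees are fixed before [b] grows; the target 2K absorbs the factor 1/2 of
   [opnorm_ge_pochhammer]. *)
have [m [M [A [m0 M0 pmA qmM KW]]]] := test_parameters t (2 * K) p1 pq c0.
near=> b.
have b0 : 0 < b by near: b; apply: nbhs_pinfty_gt; exact: num_real.
have mb : m%:R <= b by near: b; apply: nbhs_pinfty_ge; exact: num_real.
have ab : a + 1 <= b by near: b; apply: nbhs_pinfty_ge; exact: num_real.
have Bb : (2 * m * (m + M))%:R <= b.
  by near: b; apply: nbhs_pinfty_ge; exact: num_real.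
have ab0 : 0 < a + b + 1 by lra.
(* Here v = (1-x)/2 follows the Beta law with parameters a+1 and b+1, so s = a+b+2. The conditions m
   <= b and a+1 <= b bound m(m+a+b+1), the largest eigenvalue involved up to sign, by 4mb. *)
apply: le_trans (@opnorm_ge_pochhammer R a b (half_1BX R)
  (fun k => - jacobi_eigenvalue a b k) (fun k => k.+1%:R * (k.+1%:R + a))
  (a + 1) (a + b + 2) _ 1 m M A p q (expR (- t * Num.sqrt (4 * m%:R)))
  (jl_measure a b) (jl_map b) (jl_inv b) _ _ _ c0 _ _ _ _ _ _ _ _ _ _
  p1 q1 m0 M0 pmA qmM _ _ _ _ _) => //.
- by rewrite lee_fin ler_pdivlMr// mulrC.
- by lra.
- move=> x; rewrite in_itv/= => /andP[x1 x2].
  by rewrite /half_1BX !(hornerZ, hornerD, hornerN, hornerX, hornerC) mulr_ge0// subr_ge0 ltW.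
- by rewrite size_half_1BX.
- by rewrite jacobi_eigenvalue0 oppr0.
- by move=> i j ij; rewrite ltrN2; exact: jacobi_eigenvalue_lt.
- by move=> k; rewrite mulr_ge0// -natr1; have := ler0n R k; lra.
- by move=> k; rewrite jacobi_op_half_1BX /jacobi_eigenvalue opprK.
- by move=> k; rewrite /jacobi_eigenvalue opprK -natr1; ring.
- move=> n; rewrite mul1n => nm; apply: poisson_multiplier_ge => //.
  apply: (@le_trans _ _ (m%:R * (m%:R + a + b + 1))).
    rewrite /jacobi_eigenvalue opprK; have nm' : n%:R <= m%:R :> R by rewrite ler_nat.
    by have := ler0n R n; nra.
  by have := ler0n R m; nra.
- by lra.
- exact: measurable_jl_map.
- by apply: measurable_funB => //; exact: measurable_funM.
- by have [] := jl_mapK b0.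
Unshelve. all: by end_near. Qed.

Lemma cvgy_gh_opnorm (R : realType) (p q t : R) :
  1 < p -> p < q -> 0 <= t ->
  opnorm (gh_measure l) p q (gh_poisson l t) @[l --> +oo%R] --> +oo%E.
Proof.
move=> p1 pq t0; have q1 : 1 < q by exact: lt_trans pq.
have c0 : 0 < 2^-1 :> R by rewrite invr_gt0.
apply/cvgeyPge => K.
have [m [M [A [m0 M0 pmA qmM KW]]]] := test_parameters t (2 * K) p1 pq c0.
near=> l.
have l0 : 0 < l by near: l; apply: nbhs_pinfty_gt; exact: num_real.
have l1 : 1 <= l by near: l; apply: nbhs_pinfty_ge; exact: num_real.
have ml : m%:R <= l by near: l; apply: nbhs_pinfty_ge; exact: num_real.
have Bl : (2 * m * (m + M))%:R <= l.
  by near: l; apply: nbhs_pinfty_ge; exact: num_real.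
set a := l - 2^-1.
have aE x : x + a + a + 1 = x + 2 * l by rewrite /a; field.
have aa : 0 < a + a + 1 by rewrite /a; lra.
(* Here v = x^2 follows the Beta law with parameters 1/2 and l+1/2, so s = l+1, and [th k] is minus
   the eigenvalue of degree 2k. Degrees up to 2m occur, and 2m(2m+2l) is at most 4m times 2l as soon
   as m <= l. *)
apply: le_trans (@opnorm_ge_pochhammer R a a 'X^2
  (fun k => - jacobi_eigenvalue a a (2 * k)) (fun k => (2 * k.+1)%:R * (2 * k + 1)%:R)
  2^-1 (l + 1) _ 2 m M A p q (expR (- t * Num.sqrt (4 * m%:R)))
  (gh_measure l) (gh_map l) (gh_inv l) _ _ _ c0 _ _ _ _ _ _ _ _ _ _
  p1 q1 m0 M0 pmA qmM _ _ _ _ _) => //.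
- by rewrite lee_fin ler_pdivlMr// mulrC.
- by rewrite /a; lra.
- by rewrite /a; lra.
- by lra.
- by move=> x _; rewrite hornerXn sqr_ge0.
- by rewrite size_polyXn.
- by rewrite muln0 jacobi_eigenvalue0 oppr0.
- by move=> i j ij; rewrite ltrN2; apply: jacobi_eigenvalue_lt => //; rewrite ltn_pmul2l.
- by move=> k; rewrite jacobi_op_X2// /jacobi_eigenvalue opprK.
- move=> k; rewrite /jacobi_eigenvalue opprK aE.
  by rewrite !natrM natrD natrM -natr1; field.
- move=> n nm; apply: poisson_multiplier_ge => //; first by rewrite mulr_gt0.
  rewrite /jacobi_eigenvalue opprK aE.
  apply: (@le_trans _ _ ((2 * m%:R) * (2 * m%:R + 2 * l))).
    have nm' : n%:R <= 2 * m%:R :> R by rewrite -natrM ler_nat.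
    by have := ler0n R n; nra.
  by have := ler0n R m; nra.
- by lra.
- exact: measurable_gh_map.
- exact: measurable_funM.
- by have [] := gh_mapK l0.
Unshelve. all: by end_near. Qed.

Theorem theorem3p20 (R : realType) (a p q t : R)
  (ha : - 2^-1 <= a) (hp : 1 < p) (hpq : p < q) (ht : 0 < t) :
  opnorm (jl_measure a b) p q (jl_poisson a b t) @[b --> +oo%R] --> +oo%E /\
  opnorm (gh_measure l) p q (gh_poisson l t) @[l --> +oo%R] --> +oo%E.
Proof.
split; last by apply: cvgy_gh_opnorm => //; exact: ltW.
by apply: cvgy_jl_opnorm => //; [lra|exact: ltW].
Qed.
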